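(* Assume (A1)--(A5) and (A7) of the context. Let $\tau>0$ and let $\bar\omega_t\colon X\to X$, $t\in[0,T]$, be a transition rule of the minimizing movement scheme, i.e. for each $x\in X$, $t\in[0,T]$ there is a sequence $(u_s)_{s\in\mathbb N}$ in $X$ with $u_0=x$, $u_{s+1}\in\arg\min_{y\in X}\{E_t(y)+\frac1{2\tau}d(y,u_s)^2\}$ for all $s\in\mathbb N$, having $\bar\omega_t(x)$ as a cluster point. Let $E^M_{t,\tau}(x):=\inf_{y\in X}\{E_t(y)+\frac1{2\tau}d(x,y)^2\}$ and $$c^M_t(x_1,x_2):=\inf\Big\{\sum_{s=a}^b\Big(E_t(u_s)-E^M_{t,\tau}(u_s)+\frac1{2\tau}d(u_{s+1},u_s)^2\Big):\ a\le b\in\mathbb Z,\ u_a,\dots,u_b\in X,\ u_a=x_1,\ u_b=x_2\Big\},$$ where $u_{b+1}:=u_b=x_2$. Then the transition rule is compatible with the action $c^M_t$. Moreover, if $\tau\le\frac1L$ ($L$ the Lipschitz constant in (A7)), the map $c^M_t\colon X\times X\to[0,\infty)$ is an action generated by curves, with $\mathbb I=\mathbb Z$ and the following data: $\mathscr P^M:=X\times X$, with points written $\underline x=(x_0,x_1)$ and $d_{\mathscr P^M}(\underline x,\underline x')=\frac12(d(x_0,x_0')+d(x_1,x_1'))$; $i^M(x):=(x,x)$; $$\Gamma(\underline x,\underline x'):=\{\gamma=(\gamma_0,\gamma_1)\colon[a,b]_{\mathbb Z}\to\mathscr P^M:\ a<b\in\mathbb Z,\ \gamma(a)=\underline x,\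 \gamma(b)=\underline x',\ \gamma_1(s)=\gamma_0(s+1)\text{ for }s\in[a,b-1]_{\mathbb Z}\};$$ $\mathcal L^M_t(\underline x):=E_t(x_0)-E^M_{t,\tau}(x_0)+\frac1{2\tau}d(x_0,x_1)^2$; and $\mathfrak c^M_t(\underline x,\underline x'):=\inf_{\gamma\in\Gamma(\underline x,\underline x')}\sum_{s=a+1}^b\mathcal L^M_t(\gamma(s))$.
   Context: Setting: $T>0$; $(X,d)$ is a metric space; $E\colon[0,T]\times X\to\mathbb R$, written $E_t(x)$. Slope: $|\partial E_t|(x)=\limsup_{x'\to x}\frac{(E_t(x)-E_t(x'))^+}{d(x,x')}$. $\mathrm{Crit}_t=\{x\in X:|\partial E_t|(x)=0\}$. (A1) $(X,d)$ is locally compact. (A2) $E$ is continuous; it is differentiable in $t$ with $\partial_tE$ continuous on $[0,T]\times X$; and $(t,x)\mapsto|\partial E_t|(x)$ is real-valued and continuous on $[0,T]\times X$. (A3) There are $C_1,C_2>0$ with $|\partial_tE_t(x)|\le C_1E_t(x)+C_2$ for all $(t,x)$. (A4) With $G(x)=\sup_{t\in[0,T]}|E_t(x)|$, the set $\{G\le C\}$ is compact for every $C\in\mathbb R$. (A5) For every $t$, $\mathrm{Crit}_t$ is a disjoint union of well-separated compact sets (each has positive distance from the union of the others), each of them path-connected by rectifiable paths; moreover $E_t$ is constant on every path-connected component of $\mathrm{Crit}_t$. (A7) $(X,d)$ is a path space: $d(x,x')=\inf\{\int_0^1|\dot\eta(s)|ds:\eta\in AC([0,1],X),\eta(0)=x,\eta(1)=x'\}$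 ($|\dot\eta|$ the metric derivative); and there is $L>0$ with $\big||\partial E_t|(x)-|\partial E_t|(x')\big|\le L\,d(x,x')$ for all $t,x,x'$. Action: a family $(c_t)_{t\in[0,T]}$ of lower semicontinuous functions $c_t\colon X\times X\to[0,\infty)$ with $E_t(x)-E_t(x')\le c_t(x,x')$ for all $x,x',t$. A family of maps $\bar\omega_t\colon X\to X$ (transition rule) is compatible with the action if $E_t(x)-E_t(\bar\omega_t(x))=c_t(x,\bar\omega_t(x))$ for all $x,t$. Actions generated by curves: for $\mathbb I\in\{\mathbb Z,\mathbb R\}$ write $[a,b]_{\mathbb I}=[a,b]\cap\mathbb I$, $(a,b]_{\mathbb I}=(a,b]\cap\mathbb I$. An action $c_t$ is generated by curves if there are $\mathbb I\in\{\mathbb Z,\mathbb R\}$, a metric space $(\mathscr P,d_{\mathscr P})$, a map $\Gamma$ assigning to $(p_1,p_2)\in\mathscr P^2$ a set $\Gamma(p_1,p_2)$ of curves $\gamma\colon[a,b]_{\mathbb I}\to\mathscr P$ ($a<b$ in $\mathbb I$ depending on $\gamma$) with $\gamma(a)=p_1,\gamma(b)=p_2$, a closed immersion $i\colon X\to\mathscr P$ (homeomorphism onto a closed subset) and a continuous $\mathcal L\colon\mathscr P\times[0,T]\to[0,\infty)$, $(p,t)\mapsto\mathcal L_t(p)$, with $c_t(x_1,x_2)=\mathfrak c_t(i(x_1),i(x_2))$, $\mathfrak c_t(p_1,p_2):=\inf_{\gamma\in\Gamma(p_1,p_2)}\int_{(a,b]_{\mathbb I}}\mathcal L_t(\gamma(s))\,d\nu(s)$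 ($\nu$ Lebesgue measure if $\mathbb I=\mathbb R$, counting measure if $\mathbb I=\mathbb Z$), such that for every $t\in[0,T]$: (P1) restrictions to subintervals, concatenations and shifts of admissible curves are admissible: if $\gamma\in\Gamma(p_1,p_3)$ has domain $[a,b]_{\mathbb I}$ and $\gamma(s)=p_2$ with $a<s<b$, then $\gamma|_{[a,s]_{\mathbb I}}\in\Gamma(p_1,p_2)$, $\gamma|_{[s,b]_{\mathbb I}}\in\Gamma(p_2,p_3)$; if $\gamma\in\Gamma(p_1,p_2)$, $\gamma'\in\Gamma(p_2,p_3)$ have domains $[a,s]_{\mathbb I}$, $[s,b]_{\mathbb I}$, the curve equal to $\gamma$ on $[a,s]_{\mathbb I}$ and to $\gamma'$ on $(s,b]_{\mathbb I}$ is in $\Gamma(p_1,p_3)$; if $\gamma\in\Gamma(p_1,p_2)$ and $r\in\mathbb I$ then $\gamma(\cdot+r)\in\Gamma(p_1,p_2)$. (P2) $\mathcal L_t(p)=0$ iff $p=i(x)$ for some $x$ with $|\partial E_t|(x)=0$. (P3) For $x_1\ne x_2$, $c_t(x_1,x_2)=0$ iff $i(x_1),i(x_2)$ lie in the same connected component of $\{p:\mathcal L_t(p)=0\}$. (P4) For every compact $K\subset\mathscr P$ there is a compact $K'\subset\mathscr P$ (independent of $t$) such that for all $p_1,p_2\in K$ and $\varepsilon>0$ there is $\gamma\in\Gamma(p_1,p_2)$ with image in $K'$ and $\int_{(a,b]_{\mathbb I}}\mathcal L_t(\gamma(s))d\nu(s)\le\mathfrak c_t(p_1,p_2)+\varepsilon$.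 (P5) For every compact $K\subset\mathscr P$ and $\varepsilon>0$ there are $L',P>0$ such that $\mathfrak c_t(p_1,p_2)\le\varepsilon$ for all $p_1,p_2\in K$ with $\mathcal L_t(p_1)\le P$, $\mathcal L_t(p_2)\le P$, $d_{\mathscr P}(p_1,p_2)\le L'$. *)

(* Defs.v *)
From HB Require Import structures.
From mathcomp Require Import all_boot all_order all_algebra.
From mathcomp Require Import all_classical all_reals all_analysis.

Set Implicit Arguments.
Unset Strict Implicit.
Unset Printing Implicit Defensive.
Import Order.TTheory GRing.Theory Num.Theory.
Import numFieldTopology.Exports numFieldNormedType.Exports.
Local Open Scope classical_set_scope.
Local Open Scope ring_scope.

(* A function on [0, T] * X is encoded as a total function R -> X -> _ of which
   only the values at times 0 <= t <= T are ever constrained or used. *)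

Section Energy.
Context {R : realType} {X : metricType R}.
Implicit Types (E : R -> X -> R) (T : R) (f : X -> R) (t : R) (x y : X).

(* limsup over x' -> x with x' != x; the maximum with 0 only matters when x is
   isolated, where the limsup over the empty set is -oo and the slope is 0. *)
Definition slope f x : \bar R :=
  maxe 0%E
    (limf_esup (fun x' => (Num.max (f x - f x') 0 / mdist x x')%:E) x^').

Definition Crit E t : set X := [set x | slope (E t) x = 0%E].

(* difference quotients are taken within [0, T]: one-sided at t = 0 and t = T *)
Definition time_quotient T E t x : R -> R := fun s => (E s x - E t x) / (s - t).

Definition time_derivative T E t x : R :=
  lim (time_quotient T E t x s @[s --> within `[0, T] t^']).

Definition regular_energy T E : Prop :=
  [/\ {within `[0, T] `*` [set: X], continuous (fun q : R * X => E q.1 q.2)},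
      forall t x, 0 <= t <= T ->
        cvg (time_quotient T E t x s @[s --> within `[0, T] t^']),
      {within `[0, T] `*` [set: X],
        continuous (fun q : R * X => time_derivative T E q.1 q.2)},
      forall t x, 0 <= t <= T -> slope (E t) x \is a fin_num &
      {within `[0, T] `*` [set: X],
        continuous (fun q : R * X => fine (slope (E q.1) q.2))}].

Definition power_control T E : Prop :=
  exists C1 C2 : R, [/\ 0 < C1, 0 < C2 &
    forall t x, 0 <= t <= T -> `|time_derivative T E t x| <= C1 * E t x + C2].

Definition compact_sublevels T E : Prop :=
  let G x := ereal_sup [set `|E t x|%:E | t in `[0, T]] in
  forall C : R, compact [set x | (G x <= C%:E)%E].

Definition path_in (A : set X) x y (eta : R -> X) : Prop :=
  [/\ {within `[0, 1], continuous eta}, eta 0 = x, eta 1 = y &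
      forall s, 0 <= s <= 1 -> A (eta s)].

Definition rectifiable (eta : R -> X) : Prop :=
  exists M : R, forall r : seq R, itv_partition 0 1 r ->
    \sum_(0 <= k < size r)
      mdist (eta (nth 1 (0 :: r) k)) (eta (nth 1 (0 :: r) k.+1)) <= M.

Definition well_separated (F : set (set X)) : Prop :=
  forall K, F K -> exists2 delta : R, 0 < delta &
    forall x y, K x -> (\bigcup_(K' in F `\ K) K') y -> delta <= mdist x y.

Definition separated_critical_sets T E : Prop :=
  forall t, 0 <= t <= T ->
    (exists F : set (set X),
      [/\ Crit E t = \bigcup_(K in F) K, trivIset F id, well_separated F,
          forall K, F K -> compact K &
          forall K x y, F K -> K x -> K y ->
            exists2 eta, path_in K x y eta & rectifiable eta]) /\
    (forall x y, (exists eta, path_in (Crit E t) x y eta) -> E t x = E t y).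

Definition absolutely_continuous01 (eta : R -> X) : Prop :=
  exists2 g : R -> R,
    lebesgue_measure.-integrable `[0, 1] (EFin \o g) &
    forall s t, 0 <= s -> s <= t -> t <= 1 ->
      ((mdist (eta s) (eta t))%:E
         <= \int[lebesgue_measure]_(r in `[s, t]) (g r)%:E)%E.

(* The metric derivative is only defined almost everywhere:
   m is any integrable representative of it. *)
Definition metric_derivative01 (eta : R -> X) (m : R -> R) : Prop :=
  lebesgue_measure.-integrable `[0, 1] (EFin \o m) /\
  {ae (@lebesgue_measure R), forall s, 0 < s < 1 ->
    mdist (eta (s + h)) (eta s) / `|h| @[h --> 0^'] --> m s}.

Definition path_space : Prop :=
  forall x x', (mdist x x')%:E = ereal_inf
    [set l | exists eta m,
      [/\ absolutely_continuous01 eta, eta 0 = x, eta 1 = x',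
          metric_derivative01 eta m &
          l = (\int[lebesgue_measure]_(s in `[0%R, 1%R]) (m s)%:E)%E]].

Definition lipschitz_slope T E (L : R) : Prop :=
  forall t x x', 0 <= t <= T ->
    `|fine (slope (E t) x) - fine (slope (E t) x')| <= L * mdist x x'.

Definition is_action T E (c : R -> X -> X -> R) : Prop :=
  forall t, 0 <= t <= T ->
    [/\ forall x x', 0 <= c t x x',
        lower_semicontinuous (fun q : X * X => (c t q.1 q.2)%:E) &
        forall x x', E t x - E t x' <= c t x x'].

Definition compatible T E (c : R -> X -> X -> R) (omega : R -> X -> X) : Prop :=
  forall t x, 0 <= t <= T -> E t x - E t (omega t x) = c t x (omega t x).

End Energy.

Variant time_set := IntTime | RealTime.

Definition time_type (R : realType) (I : time_set) : realDomainType :=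
  match I with IntTime => int | RealTime => R end.

(* A curve [start, stop]_I -> P is encoded by a total function I -> P, up to its
   values outside of [start, stop]; see the field gbc_ext below. *)
Record curve (I P : Type) := Curve { start : I; stop : I; pos : I -> P }.

Section Curves.
Context {I : realDomainType} {P : Type}.
Implicit Types g : curve I P.

Definition subcurve g (a b : I) : curve I P := Curve a b (pos g).

Definition concat_curve g g' : curve I P :=
  Curve (start g) (stop g') (fun s => if s <= stop g then pos g s else pos g' s).

Definition shift_curve g (r : I) : curve I P :=
  Curve (start g - r) (stop g - r) (fun s => pos g (s + r)).

End Curves.

(* the integral of f along g over (start g, stop g]_I; for I = Z this is the sum
   of f (pos g s) for s = start g + 1, ..., stop g *)
Definition curve_integral (R : realType) (P : Type) (I : time_set)
    (f : P -> R) : curve (time_type R I) P -> \bar R :=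
  match I return curve (time_type R I) P -> \bar R with
  | IntTime => fun g : curve int P =>
      (\sum_(1 <= k < `|stop g - start g|%N.+1) f (pos g (start g + k%:Z)))%:E
  | RealTime => fun g : curve R P =>
      (\int[lebesgue_measure]_(s in `]start g, stop g]) (f (pos g s))%:E)%E
  end.

Definition curve_action (R : realType) (P : Type) (I : time_set)
    (Gamma : P -> P -> set (curve (time_type R I) P)) (f : P -> R)
    (p1 p2 : P) : \bar R :=
  ereal_inf [set curve_integral f g | g in Gamma p1 p2].

Definition closed_immersion (X P : topologicalType) (i : X -> P) : Prop :=
  [/\ injective i, continuous i, closed (range i) &
      forall U : set X, open U ->
        exists2 V : set P, open V & i @` U = V `&` range i].

Record generated_by_curves (R : realType) (X : metricType R) (T : R)
    (E : R -> X -> R) (c : R -> X -> X -> R)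
    (I : time_set) (P : metricType R)
    (Gamma : P -> P -> set (curve (time_type R I) P))
    (i : X -> P) (Lag : R -> P -> R) : Prop := GeneratedByCurves {
  gbc_ext : forall p1 p2 g g', Gamma p1 p2 g ->
    start g = start g' -> stop g = stop g' ->
    (forall s, start g <= s <= stop g -> pos g s = pos g' s) ->
    Gamma p1 p2 g' ;
  gbc_ends : forall p1 p2 g, Gamma p1 p2 g ->
    [/\ start g < stop g, pos g (start g) = p1 & pos g (stop g) = p2] ;
  gbc_immersion : closed_immersion i ;
  gbc_Lag_ge0 : forall t p, 0 <= t <= T -> 0 <= Lag t p ;
  gbc_Lag_continuous : {within [set: P] `*` `[0, T],
    continuous (fun q : P * R => Lag q.2 q.1)} ;
  gbc_action : forall t x1 x2, 0 <= t <= T ->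
    (c t x1 x2)%:E = curve_action Gamma (Lag t) (i x1) (i x2) ;
  gbc_restrict : forall p1 p2 p3 g s, Gamma p1 p3 g ->
    start g < s < stop g -> pos g s = p2 ->
    Gamma p1 p2 (subcurve g (start g) s) /\
    Gamma p2 p3 (subcurve g s (stop g)) ;
  gbc_concat : forall p1 p2 p3 g g', Gamma p1 p2 g -> Gamma p2 p3 g' ->
    stop g = start g' -> Gamma p1 p3 (concat_curve g g') ;
  gbc_shift : forall p1 p2 g r, Gamma p1 p2 g -> Gamma p1 p2 (shift_curve g r) ;
  gbc_zero : forall t p, 0 <= t <= T ->
    Lag t p = 0 <-> exists2 x, Crit E t x & p = i x ;
  gbc_null : forall t x1 x2, 0 <= t <= T -> x1 <> x2 ->
    c t x1 x2 = 0 <->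
    connected_component [set p | Lag t p = 0] (i x1) (i x2) ;
  gbc_compact : forall K : set P, compact K ->
    exists2 K' : set P, compact K' &
      forall t p1 p2 (e : R), 0 <= t <= T -> K p1 -> K p2 -> 0 < e ->
        exists g, [/\ Gamma p1 p2 g,
          forall s, start g <= s <= stop g -> K' (pos g s) &
          (curve_integral (Lag t) g
             <= curve_action Gamma (Lag t) p1 p2 + e%:E)%E] ;
  gbc_local : forall t, 0 <= t <= T ->
    forall (K : set P) (e : R), compact K -> 0 < e ->
      exists L' D : R, [/\ 0 < L', 0 < D &
        forall p1 p2, K p1 -> K p2 -> Lag t p1 <= D -> Lag t p2 <= D ->
          mdist p1 p2 <= L' ->
          (curve_action Gamma (Lag t) p1 p2 <= e%:E)%E]
}.

(* X * X with the metric (d(x0, x0') + d(x1, x1')) / 2, as opposed to the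
   library's product, whose balls are those of the maximum distance *)
Definition mean_prod (X : Type) : Type := (X * X)%type.

Section MeanProd.
Context {R : realType} {X : metricType R}.

HB.instance Definition _ := Choice.copy (mean_prod X) (X * X)%type.

Definition mean_dist (p q : mean_prod X) : R :=
  (mdist p.1 q.1 + mdist p.2 q.2) / 2.

Lemma mean_distxx p : mean_dist p p = 0.
Proof. by rewrite /mean_dist !mdistxx addr0 mul0r. Qed.

Lemma mean_dist_positivity p q : mean_dist p q = 0 -> p = q.
Proof.
case: p q => [x y] [x' y'] /eqP; rewrite /mean_dist/= mulf_eq0 invr_eq0.
rewrite (negbTE (_ : 2 != 0 :> R)) ?pnatr_eq0// orbF.
rewrite paddr_eq0 ?mdist_ge0// => /andP[/eqP + /eqP].
by move=> /mdist_positivity -> /mdist_positivity ->.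
Qed.

Lemma mean_dist_sym p q : mean_dist p q = mean_dist q p.
Proof. by rewrite /mean_dist metric_sym (metric_sym p.2). Qed.

Lemma mean_dist_triangle q p r :
  mean_dist p r <= mean_dist p q + mean_dist q r.
Proof.
rewrite /mean_dist -mulrDl ler_pM2r ?invr_gt0 ?ltr0n// addrACA.
by rewrite lerD// metric_triangle.
Qed.

HB.instance Definition _ := isMetric.Build R (mean_prod X)
  mean_distxx mean_dist_positivity mean_dist_sym mean_dist_triangle.

End MeanProd.

Section MinimizingMovements.
Context {R : realType} {X : metricType R}.
Variables (T : R) (E : R -> X -> R) (tau : R).
Implicit Types (t : R) (x y : X).

Definition mm_functional t x y : R := E t y + (2 * tau)^-1 * mdist y x ^+ 2.

Definition mm_argmin t x : set X :=
  [set y | forall z, mm_functional t x y <= mm_functional t x z].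

Definition mm_transition_rule (omega : R -> X -> X) : Prop :=
  forall t x, 0 <= t <= T -> exists u : nat -> X,
    [/\ u 0%N = x, forall s, mm_argmin t (u s) (u s.+1) &
        cluster (u s @[s --> \oo]) (omega t x)].

Definition mm_envelope t x : R := inf [set mm_functional t x y | y in [set: X]].

(* u is only used on {a, ..., b + 1}; u (b + 1) = u b is the convention that
   defines the last summand *)
Definition mm_action t x1 x2 : R :=
  inf [set S | exists (a b : int) (u : int -> X),
    [/\ a <= b, u a = x1, u b = x2, u (b + 1) = u b &
      S = \sum_(0 <= k < `|b - a|%N.+1)
            let s := a + k%:Z in
            (E t (u s) - mm_envelope t (u s)
               + (2 * tau)^-1 * mdist (u (s + 1)) (u s) ^+ 2)]].

Definition mm_Lag t (p : mean_prod X) : R :=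
  E t p.1 - mm_envelope t p.1 + (2 * tau)^-1 * mdist p.1 p.2 ^+ 2.

Definition mm_curves (p p' : mean_prod X) :
    set (curve (time_type R IntTime) (mean_prod X)) :=
  [set g : curve int (mean_prod X) |
    [/\ start g < stop g, pos g (start g) = p, pos g (stop g) = p' &
        forall s, start g <= s <= stop g - 1 ->
          (pos g s).2 = (pos g (s + 1)).1]].

Definition mm_diag x : mean_prod X := (x, x).

End MinimizingMovements.

(* Main.v *)
(** A summand E(u) - E^M(u) + d(u, v)^2 / (2 tau) of the action is at least
    E(u) - E(v), with equality when v minimizes the functional at u.  Along the
    minimizing movement sequence the sums therefore telescope, and at a cluster
    point the gap E - E^M vanishes by continuity of E^M, so that the last jump to
    the cluster point is almost free.

    Zeros of the Lagrangian are the diagonal points over {E = E^M}.  Such points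
    are critical by minimality; conversely, if the slope is L-Lipschitz and
    vanishes at x, integrating it along almost shortest curves gives
    E(y) >= E(x) - (L / 2) d(x, y)^2, hence E^M(x) = E(x) as tau <= 1 / L.
    This uses that an absolutely continuous curve is no shorter than the distance
    of its endpoints when its length is measured by the metric derivative.

    Chains of small cost make small jumps between points of small gap, all of
    them in one compact sublevel, hence close to the critical set; they cannot
    leave a well-separated component.  Conversely a rectifiable path of critical
    points, cut in n steps, costs at most (length) * (mesh) / (2 tau). *)

Require Import Defs.
From mathcomp Require Import all_boot all_order all_algebra.
From mathcomp Require Import ring lra.
From mathcomp Require Import all_classical all_reals all_analysis.
Set Implicit Arguments.
Unset Strict Implicit.
Unset Printing Implicit Defensive.
Import Order.TTheory GRing.Theory Num.Theory.
Import numFieldTopology.Exports numFieldNormedType.Exports.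
Local Open Scope classical_set_scope.
Local Open Scope ring_scope.

(** * Length of absolutely continuous curves *)

Section RealFunctions.
Context {R : realType}.
Notation mu := (@lebesgue_measure R).
Implicit Types (h k f g : R -> R) (a b s t x y : R).

Lemma within_continuousP {M : pseudoMetricType R} (A : set M) (f : M -> R) :
  {within A, continuous f} <->
  (forall (x : M) (e : R), A x -> 0 < e -> exists2 d : R, 0 < d &
    forall y : M, A y -> ball x d y -> `|f y - f x| < e).
Proof.
rewrite subspace_continuousP; split=> [fc x e Ax e0|fc x Ax].
  have /cvgrPdist_lt/(_ e e0) := fc x Ax.
  rewrite near_withinE => /nbhs_ballP[d d0 Hd]; exists d => // y Ay xy.
  by rewrite distrC; exact: Hd.
apply/cvgrPdist_lt => e e0; rewrite near_withinE; apply/nbhs_ballP.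
have [d d0 Hd] := fc x e Ax e0; exists d => // y xy Ay.
by rewrite distrC; exact: Hd.
Qed.

(* The supremum of the points x with h a <= h x cannot be smaller than b. *)
Lemma right_increasing_le h a b : a <= b ->
  {within `[a, b], continuous h} ->
  (forall x, a <= x < b -> \forall y \near x^'+, h x <= h y) ->
  h a <= h b.
Proof.
move=> ab hc hinc.
pose A := [set x | a <= x <= b /\ h a <= h x].
have Aa : A a by rewrite /A/= lexx ab.
have supA : has_sup A by split; [exists a|exists b => x [/andP[]]].
pose c := sup A.
have ac : a <= c by apply: ub_le_sup => //; case: supA.
have cb : c <= b by apply: ge_sup; [exists a|move=> x [/andP[]]].
(* Otherwise [h] stays below [h a] on a neighbourhood of [c] in [a, b], and this neighbourhood
   contains members of [A] because [c] is their supremum. *)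
have hac : h a <= h c.
  rewrite leNgt; apply/negP => hlt.
  have [e e0 He] : exists2 e : R, 0 < e &
      forall y, a <= y <= b -> `|c - y| < e -> h y < h a.
    have [d d0 Hd] := (within_continuousP _ _).1 hc c (h a - h c)
      (introT andP (conj ac cb)) (eqbRL (subr_gt0 _ _) hlt).
    exists d => // y yab /(Hd _ yab); rewrite ltr_distl => /andP[_].
    by rewrite subrKC.
  have [x Ax xc] := sup_adherent e0 supA.
  have xc' : x <= c by apply: ub_le_sup => //; case: supA.
  case: (Ax) => xab; rewrite leNgt => /negP; apply; apply: He => //.
  by rewrite ger0_norm ?subr_ge0// ltrBlDr addrC -ltrBlDr.
move: cb; rewrite le_eqVlt => /predU1P[<-//|cb].
have /hinc Hc : a <= c < b by rewrite ac.
have [y [cy yb hcy]] : exists y, [/\ c < y, y <= b & h c <= h y].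
  near c^'+ => y; exists y; split => //.
  by near: y; apply: nbhs_right_le.
  near: y; exact: Hc.
have : y <= c.
  apply: ub_le_sup; first by case: supA.
  by split; [rewrite yb (le_trans ac (ltW cy))|exact: le_trans hcy].
by rewrite leNgt cy.
Unshelve. all: by end_near. Qed.


Lemma Rintegral_Obnd k a x y : a <= x -> x <= y ->
  mu.-integrable setT (EFin \o k) ->
  \int[mu]_(u in `[a, y]) k u - \int[mu]_(u in `[a, x]) k u
  = \int[mu]_(u in `]x, y]) k u.
Proof.
move=> ax xy ik; apply: Rintegral_itvB; rewrite ?bnd_simp//.
exact: integrableS ik.
Qed.

Section MetricDerivative.
Context {X : metricType R}.
Implicit Types (eta : R -> X).

(* Off a null set both m and its primitive see the metric derivative, so that the
   primitive grows at least as fast as the distance to eta s.  The null set is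
   covered by an open set U of small measure, on which the integral k of
   |g| + |m| compensates for the missing information. *)
Lemma metric_derivative_dist eta (m : R -> R) s t :
  absolutely_continuous01 eta -> metric_derivative01 eta m ->
  0 <= s -> s <= t -> t <= 1 ->
  mdist (eta s) (eta t) <=
    \int[mu]_(r in `[0, t]) m r - \int[mu]_(r in `[0, s]) m r.
Proof.
move=> [g ig eta_g] [im eta_m] s0 st t1.
(* Extension by zero outside [0, 1] makes both functions integrable on the whole line. *)
pose gg := (fun x => `|x|) \o (g \_ `[0, 1]); pose mm := m \_ `[0, 1].
have patched f : mu.-integrable `[0, 1] (EFin \o f) ->
    mu.-integrable setT (EFin \o f \_ `[0, 1]).
  by move=> /(integrable_mkcond _ _).1; rewrite restrict_EFin; apply.
have igg : mu.-integrable setT (EFin \o gg).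
  have /integrable_abse := patched _ ig.
  by apply: eq_integrable.
have imm : mu.-integrable setT (EFin \o mm) := patched _ im.
have imma : mu.-integrable setT (EFin \o (fun x => `|mm x|)).
  have /integrable_abse := imm.
  by apply: eq_integrable.
have iw : mu.-integrable setT (EFin \o (gg \+ (fun x => `|mm x|))).
  by have := integrableD measurableT igg imma; apply: eq_integrable.
pose w := gg \+ (fun x => `|mm x|).
have cum_mm x : x <= 1 ->
    \int[mu]_(r in `[0, x]) m r = \int[mu]_(r in `[0, x]) mm r.
  move=> x1; apply: eq_Rintegral => r; rewrite inE/= in_itv/= => /andP[r0 rx].
  by rewrite /mm patchE mem_set//= in_itv/= r0 (le_trans rx).
have eta_gg x y : 0 <= x -> x <= y -> y <= 1 ->
    mdist (eta x) (eta y) <= \int[mu]_(r in `]x, y]) gg r.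
  move=> x0 xy y1.
  have sub01 : `[x, y] `<=` `[0, 1].
    by apply: subset_itv; rewrite bnd_simp.
  have igxy : mu.-integrable `[x, y] (EFin \o g) by apply: integrableS ig.
  have iggxy : mu.-integrable `]x, y] (EFin \o gg) by apply: integrableS igg.
  rewrite Rintegral_itv_obnd_cbnd//.
  apply: (@le_trans _ _ (\int[mu]_(r in `[x, y]) g r)).
    rewrite -lee_fin (le_trans (eta_g x y x0 xy y1))// /Rintegral fineK//.
    by apply: integrable_fin_num.
  apply: (le_trans (ler_norm _)); apply: (le_trans (le_normr_Rintegral _ _)) => //.
  rewrite le_eqVlt; apply/orP; left; apply/eqP.
  apply: eq_Rintegral => r /[!inE]/= xry.
  by rewrite /gg/= patchE mem_set//; exact: sub01.
rewrite !cum_mm ?(le_trans st)//.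
apply/ler_addgt0Pl => e e0.
(* Absolute continuity of the integral: a set of measure below [d] carries less than e / 2 of the
   integral of [gg + |mm|]. *)
have [d [d0 Hd]] := integral_normr_continuous iw (divr_gt0 e0 (ltr0n _ 2)).
have aeF : Filter (almost_everywhere mu) := ae_filter_ringOfSetsType mu.
pose primm y := \int[mu]_(r in `[0, y]) mm r.
have FTC : {ae mu, forall x, 0 < x ->
    derivable primm x 1 /\ derive1 primm x = mm x}.
  have imm0 y : mu.-integrable `[0, y] (EFin \o mm) by exact: integrableS imm.
  have lmm : locally_integrable [set: R] mm by exact: integrable_locally.
  by apply: filterS (FTC1 imm0 lmm) => x H x0; exact: H.
(* Differentiability of the primitive is only available for x > 0, so 0 joins the exceptional null
   set. *)
have not0 : {ae mu, forall x : R, x != 0}.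
  exists [set 0]; split; [exact: measurable_set1|exact: lebesgue_measure_set1|].
  by move=> x /= /negP/negPn/eqP.
have [A [mA A0 HA]] := filterI not0 (filterI FTC eta_m).
have [U [oU AU muU]] : exists U, [/\ open U, A `<=` U & (mu U < d%:E)%E].
  have [|U [oU AU UA]] := @lebesgue_regularity_outer R A d mA _ d0.
    by rewrite [X in (X < _)%E]A0 ltry.
  exists U; split => //; apply: le_lt_trans UA.
  have mU : measurable U by exact: measurable_realfun.open_measurable.
  have : (mu ((U `\` A) `|` A) <= mu (U `\` A) + mu A)%E.
    by apply: measureU2 => //; exact: measurableD.
  by rewrite [X in (_ + X)%E]A0 adde0 setUC setDUK.
have mU : measurable U by exact: measurable_realfun.open_measurable.
pose k := w \_ U.
have ik : mu.-integrable setT (EFin \o k).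
  rewrite -restrict_EFin; apply/(integrable_mkcond _ _).1 => //.
  exact: integrableS iw.
have w_ge0 x : 0 <= w x by apply: addr_ge0; exact: normr_ge0.
have k_ge0 x y : 0 <= \int[mu]_(r in `]x, y]) k r.
  by apply: Rintegral_ge0 => r _; rewrite /k patchE; case: ifP.
have k_le x y : \int[mu]_(r in `]x, y]) k r <= e / 2.
  rewrite -Rintegral_mkcondr; have -> : \int[mu]_(r in `]x, y] `&` U) w r =
    \int[mu]_(r in `]x, y] `&` U) `|w r|.
    by apply: eq_Rintegral => r _; rewrite ger0_norm.
  rewrite ltW// Hd//; first exact: measurableI.
  by apply: le_lt_trans muU; apply: le_measure; rewrite ?inE//; exact: measurableI.
have cumc f : mu.-integrable setT (EFin \o f) ->
    {within `[s, t], continuous (fun x => \int[mu]_(r in `[0, x]) f r)}.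
  move=> intf.
  have : {within `[0, 1], continuous (fun x => \int[mu]_(r in `[0, x]) f r)}.
    apply: parameterized_integral_continuous => //.
    exact: integrableS intf.
  by apply: continuous_subspaceW; apply: subset_itv; rewrite bnd_simp.
(* The [k] term compensates on [U], the linear term elsewhere; over [s, t] each adds at most e /
   2. *)
pose h x := \int[mu]_(r in `[0, x]) mm r + \int[mu]_(r in `[0, x]) k r
  + e / 2 * x - mdist (eta s) (eta x).
have dist_gg x y : 0 <= x -> x <= y -> y <= 1 ->
    `|mdist (eta s) (eta y) - mdist (eta s) (eta x)| <=
    \int[mu]_(r in `]x, y]) gg r.
  move=> x0 xy y1; apply: le_trans (eta_gg x y x0 xy y1).
  rewrite ler_distl; have := metric_triangle (eta s) (eta x) (eta y).
  have := metric_triangle (eta s) (eta y) (eta x).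
  by rewrite (metric_sym (eta y) (eta x)) -lerBlDr => -> ->.
have : h s <= h t.
  apply: right_increasing_le => //.
    have distc : {within `[s, t], continuous (fun x => mdist (eta s) (eta x))}.
      apply/within_continuousP => x d' /= xst d'0.
      have [d1 d10 Hd1] := (within_continuousP _ _).1 (cumc _ igg) x d' xst d'0.
      exists d1 => // y yst /(Hd1 _ yst); apply: le_lt_trans.
      move: xst yst; rewrite /= !in_itv/= => /andP[sx xt] /andP[sy yt].
      have [xy|/ltW yx] := leP x y.
        rewrite Rintegral_Obnd ?(le_trans s0)//.
        rewrite (le_trans (dist_gg x y _ _ _))// ?(le_trans _ t1)// ?(le_trans s0)//.
        exact: ler_norm.
      rewrite distrC [leRHS]distrC Rintegral_Obnd ?(le_trans s0)//.
      rewrite (le_trans (dist_gg y x _ _ _))// ?(le_trans _ t1)// ?(le_trans s0)//.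
      exact: ler_norm.
    move=> x; apply: cvgB; last exact: distc.
    apply: cvgD; first by apply: cvgD; [exact: (cumc _ imm)|exact: (cumc _ ik)].
    apply: cvgM; first exact: cvg_cst.
    exact: (@continuous_subspaceT _ _ `[s, t]%classic idfun (fun=> cvg_id)).
  move=> x /andP[sx xt].
  have x0 : 0 <= x := le_trans s0 sx.
  (* On [U], [k] equals [gg + |mm|] just to the right of [x]: the first summand bounds the change of
     the distance, the second that of the primitive. *)
  have [Ux|nUx] := pselect (U x).
    have [d' /= d'0 xU] : nbhs_ball x U by apply/nbhs_ballP; exact: open_nbhs_nbhs.
    near=> y.
    have xy : x < y by near: y; exact: nbhs_right_gt.
    have yt : y <= t by near: y; exact: nbhs_right_le.
    have yd : y < x + d' by near: y; apply: nbhs_right_lt; rewrite ltrDl.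
    have kw : \int[mu]_(r in `]x, y]) k r = \int[mu]_(r in `]x, y]) w r.
      apply: eq_Rintegral => r; rewrite inE/= in_itv/= => /andP[xr ry].
      rewrite /k patchE mem_set//; apply: xU; rewrite /ball/=.
      by rewrite ltr0_norm ?subr_lt0// opprB ltrBlDl (le_lt_trans ry).
    have := Rintegral_Obnd x0 (ltW xy) ik; rewrite kw RintegralD//=; last 2 first.
      exact: integrableS igg.
      exact: integrableS imma.
    have := dist_gg x y x0 (ltW xy) (le_trans yt t1).
    have : `|\int[mu]_(r in `]x, y]) mm r| <= \int[mu]_(r in `]x, y]) `|mm r|.
      by apply: le_normr_Rintegral => //; exact: integrableS imm.
    have := Rintegral_Obnd x0 (ltW xy) imm.
    have : e / 2 * x <= e / 2 * y by rewrite ler_pM2l ?divr_gt0// ltW.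
    have arith (mx my dm am kx ky dg ex ey dx dy : R) :
      ex <= ey -> my - mx = dm -> `|dm| <= am -> `|dy - dx| <= dg ->
      ky - kx = dg + am -> mx + kx + ex - dx <= my + ky + ey - dy.
      by clear; rewrite !ler_norml; lra.
    exact: arith.
  (* Off [U] both difference quotients at [x] converge to [mm x]; once within e / 4 of it they
     differ by at most e / 2, the slope of the linear term of [h]. *)
  have [xn0 [Fx etax]] : (x != 0 /\
    (0 < x -> derivable primm x 1 /\ derive1 primm x = mm x) /\ (0 < x < 1 ->
      mdist (eta (x + h)) (eta x) / `|h| @[h --> 0^'] --> m x)).
    by apply: contrapT => nx; apply: nUx; apply: AU; exact: HA.
  have xgt0 : 0 < x by rewrite lt_neqAle eq_sym xn0.
  have x1 : x < 1 := lt_le_trans xt t1.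
  have {Fx} [dF dFx] := Fx xgt0.
  have {}etax : mdist (eta (x + h)) (eta x) / `|h| @[h --> 0^'] --> mm x.
    by rewrite /mm patchE mem_set/= ?in_itv/= ?x0 ?ltW//; apply: etax; rewrite xgt0.
  rewrite derive1E in dFx.
  have e4 : 0 < e / 4 by rewrite divr_gt0.
  move: (dF) => /cvgrPdist_lt/(_ _ e4)[d1 /= d10 H1].
  move/cvgrPdist_lt : etax => /(_ _ e4)[d2 /= d20 H2].
  near=> y.
  have xy : x < y by near: y; exact: nbhs_right_gt.
  have yt : y <= t by near: y; exact: nbhs_right_le.
  have yd1 : y < x + d1 by near: y; apply: nbhs_right_lt; rewrite ltrDl.
  have yd2 : y < x + d2 by near: y; apply: nbhs_right_lt; rewrite ltrDl.
  have yx0 : y - x != 0 by rewrite subr_eq0 gt_eqF.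
  have yx_gt0 : 0 < y - x by rewrite subr_gt0.
  have {}H1 := H1 (y - x) _ yx0.
  have {}H2 := H2 (y - x) _ yx0.
  move: H1 H2; rewrite /ball_/= sub0r normrN gtr0_norm// ltrBlDl yd1 ltrBlDl yd2.
  rewrite subrKC (_ : lim _ = mm x); last exact: dFx.
  rewrite /GRing.scale/= mulr1 subrK => /(_ isT) H1 /(_ isT) H2; move: H1 H2.
  have := k_ge0 x y; rewrite -(Rintegral_Obnd x0 (ltW xy) ik).
  have := metric_triangle (eta s) (eta x) (eta y).
  rewrite (metric_sym (eta x)).
  have arith (m' Mx My kx ky dx dy dd : R) : dy <= dx + dd -> 0 <= ky - kx ->
      `|m' - (y - x)^-1 * (My - Mx)| < e / 4 -> `|m' - dd / (y - x)| < e / 4 ->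
      Mx + kx + e / 2 * x - dx <= My + ky + e / 2 * y - dy.
    rewrite !ltr_norml => dyx k0 /andP[_ +] /andP[+ _].
    rewrite ltrBlDl -ltrBlDr ltr_pdivlMl// => H1.
    rewrite ltrBrDl -ltrBrDr opprK ltr_pdivrMr// => H2.
    by move: dyx k0 H1 H2; clear; lra.
  exact: arith.
have := Rintegral_Obnd s0 st ik; have := k_le s t.
have : e / 2 * t <= e / 2 + e / 2 * s.
  rewrite -lerBlDr -mulrBr -[leRHS]mulr1 ler_pM2l ?divr_gt0//.
  by rewrite lerBlDr (le_trans t1)// lerDl.
have arith (a b c d' u v e' f i : R) : u <= e' / 2 + v -> f <= e' / 2 ->
    c - d' = f -> b + d' + v - 0 <= a + c + u - i -> i <= e' + (a - b).
  by clear; lra.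
by rewrite /h mdistxx; exact: arith.
Unshelve. all: by end_near. Qed.

End MetricDerivative.
End RealFunctions.

(** * Metric slope *)

Section Slope.
Context {R : realType} {X : metricType R}.
Notation mu := (@lebesgue_measure R).
Implicit Types (f : X -> R) (x y : X).

Lemma nbhs_mdistP x (P : X -> Prop) :
  nbhs x P <-> exists2 d : R, 0 < d & forall y, mdist x y < d -> P y.
Proof.
split=> [/nbhs_ballP[d /= d0 Hd]|[d d0 Hd]].
  by exists d => // y xy; apply: Hd; rewrite ballEmdist.
by apply/nbhs_ballP; exists d => // y; rewrite ballEmdist; exact: Hd.
Qed.

(** [len] is the primitive of the metric derivative of an almost shortest curve. Its increments
    bound distances, which also gives the continuity of [eta]. *)
Lemma path_space_length x y (e : R) : @path_space R X -> 0 < e ->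
  exists (eta : R -> X) (len : R -> R),
    [/\ eta 0 = x, eta 1 = y, len 0 = 0, len 1 < mdist x y + e &
      {within `[0, 1], continuous len} /\
      forall s t, 0 <= s -> s <= t -> t <= 1 ->
        mdist (eta s) (eta t) <= len t - len s].
Proof.
move=> /(_ x y) dist_inf e0.
have : (ereal_inf [set l | exists eta m, [/\ absolutely_continuous01 eta,
    eta 0%R = x, eta 1%R = y, metric_derivative01 eta m &
    l = \int[mu]_(s in `[0%R, 1%R]) (m s)%:E]] < (mdist x y + e)%:E)%E.
  by rewrite -dist_inf lte_fin ltrDl.
move/ereal_inf_lt => [_ [eta [m [eta_ac eta0 eta1 eta_m ->]]] lt_e].
exists eta, (fun t => \int[mu]_(r in `[0, t]) m r); split => //.
- by rewrite set_itv1 Rintegral_set1.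
- rewrite -lte_fin /Rintegral fineK//; apply: integrable_fin_num => //.
  by case: eta_m.
- split=> [|s t s0 st t1]; last exact: metric_derivative_dist.
  by apply: parameterized_integral_continuous => //; case: eta_m.
Qed.

Lemma slope_ge0 f x : (0 <= slope f x)%E.
Proof. by rewrite /slope le_max lexx. Qed.

Lemma slope_near f x (e : R) : slope f x \is a fin_num -> 0 < e ->
  \forall y \near x, f x - f y <= (fine (slope f x) + e) * mdist x y.
Proof.
move=> sfin e0.
have : (limf_esup (fun y => (Num.max (f x - f y) 0 / mdist x y)%:E) x^'
    < (fine (slope f x) + e)%:E)%E.
  apply: (@le_lt_trans _ _ (slope f x)); first by rewrite /slope le_max lexx orbT.
  by rewrite -[ltLHS]fineK// lte_fin ltrDl.
move/ereal_inf_lt => [_ [V xV <-] lt_e].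
move: xV; rewrite /dnbhs/= => /nbhs_mdistP[d d0 Hd].
apply/nbhs_mdistP; exists d => // y xy.
have [->|yx] := eqVneq y x; first by rewrite subrr mdistxx mulr0.
rewrite -ler_pdivrMr ?mdist_gt0 1?eq_sym//.
have : ((Num.max (f x - f y) 0 / mdist x y)%:E <= (fine (slope f x) + e)%:E)%E.
  apply: le_trans (ltW lt_e); apply: ereal_sup_ubound; exists y => //.
  exact: Hd.
rewrite lee_fin; apply: le_trans.
by rewrite ler_pM2r ?invr_gt0 ?mdist_gt0 1?eq_sym// le_max lexx.
Qed.

(** After division by [mdist x y] the bound is still linear in the distance, hence tends to 0. *)
Lemma slope0_quadratic f x (c : R) :
  (forall y, f x - f y <= c * mdist x y ^+ 2) -> slope f x = 0%E.
Proof.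
move=> fc; apply/eqP; rewrite eq_le slope_ge0 andbT ge_max lexx/=.
apply/lee_addgt0Pr => e e0; rewrite add0e.
apply: (@le_trans _ _ (ereal_sup ((fun y => (Num.max (f x - f y) 0 / mdist x y)%:E)
    @` [set y | y != x /\ mdist x y < e / (`|c| + 1)]))).
  apply: ereal_inf_lbound; exists [set y | y != x /\ mdist x y < e / (`|c| + 1)] => //.
  rewrite /dnbhs/= /within/=; apply/nbhs_mdistP.
  by exists (e / (`|c| + 1)); [rewrite divr_gt0// ltr_wpDl|].
apply: ge_ereal_sup => _ [y [yx xy] <-]; rewrite lee_fin.
have d0 : 0 < mdist x y by rewrite mdist_gt0 eq_sym.
rewrite ler_pdivrMr// ge_max; apply/andP; split; last by rewrite mulr_ge0 ?ltW.
rewrite (le_trans (fc y))// expr2 mulrA ler_pM2r// ltW//.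
move: xy; rewrite ltr_pdivlMr ?ltr_wpDl// => xy; apply: le_lt_trans xy.
rewrite mulrC ler_pM2l// (le_trans (ler_norm _))// lerDl//.
Qed.

Lemma continuous_mdistP f : continuous f <->
  forall x (e : R), 0 < e -> exists2 d : R, 0 < d &
    forall y, mdist x y < d -> `|f y - f x| < e.
Proof.
split=> [fc x e e0|fc x].
  have /cvgrPdist_lt/(_ e e0)/nbhs_mdistP[d d0 Hd] := fc x.
  by exists d => // y /Hd; rewrite distrC.
apply/cvgrPdist_lt => e /(fc x)[d d0 Hd]; apply/nbhs_mdistP.
by exists d => // y /Hd; rewrite distrC.
Qed.

(** Along an almost shortest curve from [x] the slope is at most [L * len r], so [f] loses at most
    the integral of this bound. The parameter [e] covers both the excess length and the slack in the
    slope. *)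
Lemma slope_lipschitz_quadratic f (L : R) x y : @path_space R X ->
  continuous f -> 0 <= L -> (forall z, slope f z \is a fin_num) ->
  (forall z z', `|fine (slope f z) - fine (slope f z')| <= L * mdist z z') ->
  slope f x = 0%E -> f x - f y <= L / 2 * mdist x y ^+ 2.
Proof.
move=> ps fc L0 sfin slip sx0.
have step e : 0 < e ->
    f x - f y <= L / 2 * (mdist x y + e) ^+ 2 + e * (mdist x y + e).
  move=> e0.
  have [eta [len [eta0 eta1 len0 len1 [lenc eta_len]]]] := path_space_length x y ps e0.
  (* The terms added to [f (eta r)] form the primitive of [L * l + e] in the length variable, so
     that [h] should increase. *)
  pose h r := L / 2 * len r ^+ 2 + e * len r + f (eta r).
  have len_le s t : 0 <= s -> s <= t -> t <= 1 -> len s <= len t.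
    move=> s0 st t1; rewrite -subr_ge0.
    by rewrite (le_trans _ (eta_len s t s0 st t1))// mdist_ge0.
  have len_ge0 t : 0 <= t -> t <= 1 -> 0 <= len t.
    by move=> t0 t1; rewrite -len0 len_le.
  have eta_near r d : 0 <= r <= 1 -> 0 < d -> exists2 d' : R, 0 < d' &
      forall r', 0 <= r' <= 1 -> `|r - r'| < d' -> mdist (eta r) (eta r') < d.
    move=> r01 d0.
    have [|d' d'0 Hd'] := (within_continuousP _ _).1 lenc r d _ d0.
      by rewrite /= in_itv.
    exists d' => // r' r'01 rr'.
    have : `|len r' - len r| < d by apply: Hd' => //; rewrite /= in_itv.
    move: r01 r'01 => /andP[r0 r1] /andP[r'0 r'1].
    have [rr|/ltW rr] := leP r r'.
      by rewrite ger0_norm ?subr_ge0 ?len_le//; apply: le_lt_trans; exact: eta_len.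
    rewrite distrC metric_sym ger0_norm ?subr_ge0 ?len_le//.
    by apply: le_lt_trans; exact: eta_len.
  have : h 0 <= h 1.
    apply: right_increasing_le => //.
      have fetac : {within `[0, 1], continuous (f \o eta)}.
        apply/within_continuousP => r d /=; rewrite in_itv/= => r01 d0.
        have [d1 d10 Hd1] := (continuous_mdistP f).1 fc (eta r) d d0.
        have [d2 d20 Hd2] := eta_near r d1 r01 d10.
        by exists d2 => // r' /= + rr'; rewrite in_itv/= => r'01; exact/Hd1/Hd2.
      move=> r; apply: cvgD; last exact: fetac.
      apply: cvgD; apply: cvgM; try exact: cvg_cst; last exact: lenc.
      by rewrite expr2; apply: cvgM; exact: lenc.
    move=> r /andP[r0 r1].
    have [d1 d10 Hd1] := (nbhs_mdistP _ _).1 (slope_near (sfin (eta r)) e0).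
    have [|d2 d20 Hd2] := eta_near r d1 _ d10; first by rewrite r0 ltW.
    near=> r'.
    have rr' : r < r' by near: r'; exact: nbhs_right_gt.
    have r'1 : r' <= 1 by near: r'; exact: nbhs_right_le.
    have r'd : r' < r + d2 by near: r'; apply: nbhs_right_lt; rewrite ltrDl.
    have rd : mdist (eta r) (eta r') < d1.
      apply: Hd2; first by rewrite r'1 (le_trans r0 (ltW rr')).
      by rewrite ltr0_norm ?subr_lt0// opprB ltrBlDl.
    have := Hd1 _ rd.
    have : fine (slope f (eta r)) <= L * len r.
      have := slip (eta r) x; rewrite sx0 subr0 => /(le_trans (ler_norm _)) /le_trans.
      apply; apply: ler_wpM2l => //; rewrite metric_sym.
      by have := eta_len 0 r (lexx 0) r0 (ltW r1); rewrite len0 subr0 eta0.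
    have := eta_len r r' r0 (ltW rr') r'1.
    have := len_le r r' r0 (ltW rr') r'1.
    have := len_ge0 r r0 (ltW r1).
    rewrite /h; move: (len r) (len r') (fine _).
    move: (mdist (eta r) (eta r')) (mdist_ge0 (eta r) (eta r')) (f _) (f _).
    move=> D D0 fr fr' l l' s l0 ll' Dl sL H.
    have : (s + e) * D <= (L * l + e) * (l' - l).
      apply: (@le_trans _ _ ((L * l + e) * D)); first by rewrite ler_wpM2r// lerD2r.
      by rewrite ler_wpM2l// addr_ge0 ?mulr_ge0// ltW.
    (* This is the surplus of [L / 2 * (l' ^+ 2 - l ^+ 2)] over its linearization
       [L * l * (l' - l)]. *)
    have : 0 <= L / 2 * (l' - l) ^+ 2 by rewrite mulr_ge0 ?sqr_ge0// divr_ge0.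
    by move: H; clear; nra.
  rewrite /h len0 expr0n/= !mulr0 !add0r eta0 eta1 -lerBlDr => /le_trans; apply.
  have l10 := len_ge0 1 ler01 (lexx 1).
  apply: lerD; last by rewrite ler_pM2l// ltW.
  rewrite ler_wpM2l ?divr_ge0// lerXn2r ?nnegrE ?(ltW len1)//.
  by rewrite addr_ge0 ?mdist_ge0 ?ltW.
apply/ler_addgt0Pl => e e0.
set D := mdist x y in step *; have D0 : 0 <= D by exact: mdist_ge0.
(* Expanding the bound at [D + e'] with e' <= 1 leaves an error of at most [e' * c] beyond
   [L / 2 * D ^+ 2]. *)
pose c := L * D + L / 2 + D + 1.
have c0 : 0 < c by rewrite ltr_wpDl// !addr_ge0 ?mulr_ge0 ?invr_ge0.
pose e' := Num.min 1 (e / c).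
have e'0 : 0 < e' by rewrite lt_min ltr01 divr_gt0.
have e'1 : e' <= 1 by rewrite ge_min lexx.
have e'c : e' * c <= e by rewrite -ler_pdivlMr// ge_min lexx orbT.
have : e' ^+ 2 <= e' by rewrite expr2 ler_piMl// ltW.
have : 0 <= e' * (1 - e') by rewrite mulr_ge0 ?subr_ge0// ltW.
have : 0 <= L * (e' * (1 - e')) by rewrite !mulr_ge0 ?subr_ge0// ltW.
have := step e' e'0; move: e'c; rewrite /c; clear -e'; lra.
Unshelve. all: by end_near. Qed.

End Slope.

(** * Gronwall estimate for the energy *)

Section Gronwall.
Context {R : realType}.

(** Integrating factor: the derivative of the product is [expR (c * t) * (df t + c * f t)]. *)
Lemma expR_mul_ndecr (f df : R -> R) (c T : R) :
  {within `[0, T], continuous f} ->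
  (forall t, 0 < t < T -> is_derive t 1 f (df t)) ->
  (forall t, 0 < t < T -> 0 <= df t + c * f t) ->
  forall s t, 0 <= s -> s <= t -> t <= T ->
    expR (c * s) * f s <= expR (c * t) * f t.
Proof.
move=> fc fd dfc s t s0 st tT.
pose g (r : R) := expR (c * r) * f r.
have gd r : 0 < r < T -> is_derive r 1 g (expR (c * r) * (df r + c * f r)).
  move=> /fd fr; rewrite /g.
  have er : is_derive r 1 (fun r => expR (c * r)) (c * expR (c * r)).
    have cr : is_derive r (1 : R) (fun r => c * r) c.
      by have := is_deriveZ c (is_derive_id r (1 : R)); rewrite /GRing.scale/= mulr1.
    have := @is_derive1_comp _ expR (fun r => c * r) r _ _ (is_derive_expR _) cr.
    by rewrite [_ * c]mulrC.
  have := is_deriveM er fr; move=> H; apply: (@is_derive_eq _ _ _ _ _ _ _ _ H).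
  by rewrite /GRing.scale/=; ring.
have gc : {within `[0, T], continuous g}.
  move=> r; apply: cvgM; last exact: fc.
  apply: (@continuous_subspaceT _ _ `[0, T]%classic (fun r => expR (c * r))) => u.
  apply: (@continuous_comp _ _ _ ( *%R c) expR); last exact: continuous_expR.
  exact: mulrl_continuous.
have := ger0_derive1_le_cc _ _ gc; apply => //.
- by move=> r; rewrite in_itv/= => /gd[].
- move=> r; rewrite in_itv/= => r0T.
  rewrite derive1E (@derive_val _ _ _ _ _ _ _ (gd r r0T)).
  by rewrite mulr_ge0 ?expR_ge0// dfc.
- by rewrite in_itv/= s0 (le_trans st).
- by rewrite in_itv/= tT (le_trans s0).
Qed.

(** Forward in time the integrating factor is applied to [- f] with rate [- C], backward in time to
    [f] with rate [C]. *)
Lemma gronwall (f df : R -> R) (C T : R) :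
  {within `[0, T], continuous f} ->
  (forall t, 0 < t < T -> is_derive t 1 f (df t)) ->
  (forall t, 0 < t < T -> `|df t| <= C * f t) ->
  forall s t, 0 <= s <= T -> 0 <= t <= T -> f t <= expR (C * `|t - s|) * f s.
Proof.
move=> fc fd dfC s t /andP[s0 sT] /andP[t0 tT].
have [st|/ltW ts] := leP s t.
  have fNc : {within `[0, T], continuous (fun r => - f r)}.
    by move=> r; apply: cvgN; exact: fc.
  have fNd r : 0 < r < T -> is_derive r 1 (fun r => - f r) (- df r).
    by move=> /fd fr; exact: is_deriveN.
  have := @expR_mul_ndecr _ _ (- C) T fNc fNd _ s t s0 st tT.
  rewrite !mulrN lerN2 !mulNr ger0_norm ?subr_ge0// mulrBr expRD expRN expRN.
  rewrite -mulrA -[f t <= _]ler_pdivrMl ?expR_gt0// => H; apply: H => r r0T.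
  have := dfC r r0T; rewrite ler_norml => /andP[_ +].
  by rewrite mulrNN; lra.
have := expR_mul_ndecr fc fd _ t0 ts sT.
move=> /(_ C); rewrite ler0_norm ?subr_le0// opprB mulrBr expRD expRN.
rewrite [expR _ / _]mulrC -mulrA -[f t <= _]ler_pdivrMl ?invr_gt0 ?expR_gt0// invrK.
apply => r r0T; have := dfC r r0T; rewrite ler_norml; lra.
Qed.

End Gronwall.

Section Energy.
Context {R : realType} {X : metricType R}.
Variables (T : R) (E : R -> X -> R).
Hypothesis E_regular : regular_energy T E.
Implicit Types (s t : R) (x y z : X).

Lemma energy_within_continuous x : {within `[0, T], continuous (E ^~ x)}.
Proof.
case: E_regular => + _ _ _ _ => /within_continuousP Ec.
apply/within_continuousP => t e /= t0T e0.
have [d d0 Hd] := Ec (t, x) e (conj t0T I) e0.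
exists d => // s sT ts; apply: (Hd (s, x)) => //.
by split => //=; exact: ballxx.
Qed.

Lemma energy_continuous t : 0 <= t <= T -> continuous (E t).
Proof.
case: E_regular => + _ _ _ _ => /within_continuousP Ec t0T.
apply/continuous_mdistP => x e e0.
have tT : `[0, T]%classic t by rewrite /= in_itv.
have [d d0 Hd] := Ec (t, x) e (conj tT I) e0.
exists d => // y xy; apply: (Hd (t, y)) => //.
by split => /=; [exact: ballxx|rewrite ballEmdist].
Qed.

(** At an interior time small increments stay in [0, T], so the restricted quotient is the two-sided
    one. *)
Lemma energy_is_derive t x : 0 < t < T ->
  is_derive t 1 (E ^~ x) (time_derivative T E t x).
Proof.
move=> /andP[t0 tT].
have t0T : 0 <= t <= T by rewrite !ltW.
case: E_regular => _ /(_ t x t0T) + _ _ _ => /cvgrPdist_lt Ed.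
have Hd : h^-1 *: (E (h *: 1 + t) x - E t x) @[h --> 0^'] --> time_derivative T E t x.
  apply/cvgrPdist_lt => e /Ed; rewrite near_withinE.
  move=> [d /= d0 Hd]; near=> h.
  have h0 : h != 0 by near: h; exact: nbhs_dnbhs_neq.
  have hd : `|h| < d by near: h; apply: dnbhs0_lt.
  have ht : `|h| < t by near: h; apply: dnbhs0_lt.
  have hT : `|h| < T - t by near: h; apply: dnbhs0_lt; rewrite subr_gt0.
  move: ht hT; rewrite (ltr_norml h t) (ltr_norml h (T - t)) => /andP[ht _] /andP[_ hT].
  have := Hd (h + t).
  rewrite /time_quotient addrK /GRing.scale/= mulr1 [h^-1 * _]mulrC; apply.
  - by rewrite opprD addrCA subrr addr0 normrN.
  - by rewrite -subr_eq0 addrK.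
  - by rewrite in_itv/=; move: ht hT; clear; lra.
by split; [apply/cvg_ex; exists (time_derivative T E t x)|exact: cvg_lim].
Unshelve. all: by end_near. Qed.

Lemma energy_joint_continuous t x (e : R) : 0 <= t <= T -> 0 < e ->
  exists2 d : R, 0 < d & forall s y, 0 <= s <= T -> `|t - s| < d ->
    mdist x y < d -> `|E s y - E t x| < e.
Proof.
case: E_regular => + _ _ _ _ => /within_continuousP Ec t0T e0.
have tT : `[0, T]%classic t by rewrite /= in_itv.
have [d d0 Hd] := Ec (t, x) e (conj tT I) e0.
exists d => // s y s0T st xy; apply: (Hd (s, y)).
  by split => //=; rewrite in_itv.
by split => //=; rewrite ballEmdist.
Qed.

(** The shift [K = C2 / C1] turns the affine bound on the time derivative into the linear bound
    [C1 * (E + K)], which is nonnegative since it dominates an absolute value. *)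
Lemma energy_gronwall : power_control T E -> exists C K : R,
  [/\ 0 < C, forall t x, 0 <= t <= T -> 0 <= E t x + K &
    forall s t x, 0 <= s <= T -> 0 <= t <= T ->
      E t x + K <= expR (C * `|t - s|) * (E s x + K)].
Proof.
move=> [C1 [C2 [C10 C20 dE]]]; exists C1, (C2 / C1).
have EC t x : C1 * (E t x + C2 / C1) = C1 * E t x + C2.
  by rewrite mulrDr [C1 * (C2 / _)]mulrC divfK ?gt_eqF.
split=> // [t x t0T|s t x s0T t0T].
  by rewrite -(pmulr_rge0 _ C10) EC (le_trans _ (dE t x t0T)).
apply: (@gronwall _ (fun t => E t x + C2 / C1) (fun t => time_derivative T E t x)
  _ T _ _ _ s t s0T t0T).
- move=> r; apply: cvgD; last exact: cvg_cst.
  exact: (@energy_within_continuous x).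
- move=> r r0T; rewrite -[time_derivative _ _ _ _]addr0.
  exact: is_deriveD (energy_is_derive x r0T) (is_derive_cst _ _ _).
- by move=> r /andP[r0 rT]; rewrite EC dE// !ltW.
Qed.

End Energy.

(** * The space of pairs and its discrete curves *)

Section Curves.
Context {R : realType} {X : metricType R}.
Implicit Types (p q : mean_prod X) (g : curve int (mean_prod X)).

Lemma mm_curves_ext p q g g' : mm_curves p q g ->
  start g = start g' -> stop g = stop g' ->
  (forall s, start g <= s <= stop g -> pos g s = pos g' s) ->
  mm_curves p q g'.
Proof.
case: g g' => a b w [a' b' w'] [/= ab wa wb w12] <- <- {a' b'} ww'.
have abW := ltW ab.
split=> //=; [by rewrite -ww' ?lexx|by rewrite -ww' ?lexx ?andbT|].
move=> s /andP[sa sb]; have sb1 : s + 1 <= b by rewrite -lerBrDr.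
have sb0 : s <= b by rewrite (le_trans _ sb1)// lerDl.
rewrite -!ww' ?w12 ?sa ?sb//.
by rewrite sb1 (le_trans sa)// lerDl.
Qed.

Lemma mm_curves_restrict p q r g (s : int) : mm_curves p r g ->
  start g < s < stop g -> pos g s = q ->
  mm_curves p q (subcurve g (start g) s) /\
  mm_curves q r (subcurve g s (stop g)).
Proof.
case: g => a b w [/= ab wa wb w12] /andP[sa sb] ws.
split; split => //= z /andP[za zb]; apply: w12; rewrite ?za ?zb ?andbT/=.
  by rewrite (le_trans zb)// lerD2r ltW.
by rewrite (le_trans _ za)// ltW.
Qed.

Lemma mm_curves_concat p q r g g' : mm_curves p q g -> mm_curves q r g' ->
  stop g = start g' -> mm_curves p r (concat_curve g g').
Proof.
case: g g' => a b w [a' b' w'] [/= ab wa wb w12] [/= a'b' wa' wb' w12'] bE.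
rewrite -{}bE {a'} in a'b' wa' w12' *.
split; rewrite /concat_curve/=.
- exact: lt_trans a'b'.
- by rewrite ltW.
- by rewrite leNgt a'b'.
(* At the joint z = b the current point comes from the first curve and the next one from the second;
   they match because both curves take the value [q] there. *)
- move=> z /andP[za zb]; have [zb1|zb1|->] := ltgtP z b.
  + by rewrite lezD1 zb1 w12// za/= lerBrDr lezD1.
  + by rewrite lezD1 ltNge (ltW zb1)/= w12'// ltW.
  + by rewrite lezD1 ltxx wb -wa' w12'// lexx/= lerBrDr lezD1.
Qed.

Lemma mm_curves_shift p q g (r : int) :
  mm_curves p q g -> mm_curves p q (shift_curve g r).
Proof.
case: g => a b w [/= ab wa wb w12].
split; rewrite /= ?ltrD2r ?subrK// => z /andP[za zb].
by rewrite [z + 1 + r]addrAC w12// -lerBlDr za/= -lerBrDr addrAC.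
Qed.

Lemma mdist_mean p q : mdist p q = (mdist p.1 q.1 + mdist p.2 q.2) / 2.
Proof. by []. Qed.

Lemma mdist_mean_fst p q : mdist p.1 q.1 <= 2 * mdist p q.
Proof. by rewrite mdist_mean mulrC divfK// lerDl mdist_ge0. Qed.

Lemma mdist_mean_snd p q : mdist p.2 q.2 <= 2 * mdist p q.
Proof. by rewrite mdist_mean mulrC divfK// lerDr mdist_ge0. Qed.

Lemma mdist_diag x y : mdist (mm_diag x) (mm_diag y : mean_prod X) = mdist x y.
Proof. by rewrite mdist_mean/=; lra. Qed.

Lemma lipschitz_mdist_continuous (M N : metricType R) (f : M -> N) (k : R) :
  (forall x y, mdist (f x) (f y) <= k * mdist x y) -> continuous f.
Proof.
move=> fk x A /nbhs_mdistP[d d0 Hd]; apply/nbhs_mdistP.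
have k0 : 0 < `|k| + 1 by rewrite ltr_wpDl.
exists (d / (`|k| + 1)); first by rewrite divr_gt0.
move=> y; rewrite ltr_pdivlMr// => xy; apply/Hd/(le_lt_trans (fk x y)).
apply: le_lt_trans xy; rewrite mulrC ler_wpM2l ?mdist_ge0//.
by rewrite (le_trans (ler_norm _))// lerDl.
Qed.

Lemma mm_diag_continuous : continuous (@mm_diag R X : X -> mean_prod X).
Proof.
by apply: (@lipschitz_mdist_continuous _ _ _ 1) => x y; rewrite mdist_diag mul1r.
Qed.

Lemma mean_fst_continuous : continuous (fst : mean_prod X -> X).
Proof. by apply: (@lipschitz_mdist_continuous _ _ _ 2) => p q; exact: mdist_mean_fst. Qed.

Lemma mean_snd_continuous : continuous (snd : mean_prod X -> X).
Proof. by apply: (@lipschitz_mdist_continuous _ _ _ 2) => p q; exact: mdist_mean_snd. Qed.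

(** The identity from the library's product to [mean_prod X] is continuous, so compactness of the
    product set is transported. *)
Lemma mean_prod_compact (A : set X) : compact A ->
  compact [set p : mean_prod X | A p.1 /\ A p.2].
Proof.
move=> cA; have cAA := compact_setX cA cA.
have -> : [set p : mean_prod X | A p.1 /\ A p.2] =
    (id : X * X -> mean_prod X) @` (A `*` A).
  by apply/seteqP; split=> [p []|p [q []]] /=; [exists p|move=> ? ? <-].
apply: continuous_compact => //; apply: continuous_subspaceT => -[x y] B.
move=> /nbhs_mdistP[d d0 Hd]; exists (ball x d, ball y d).
  by split; exact: nbhsx_ballx.
move=> [x' y'] /= []; rewrite !ballEmdist /= => xx' yy'.
by apply: Hd; rewrite mdist_mean/=; lra.
Qed.

Lemma mm_diag_closed_immersion : closed_immersion (@mm_diag R X : X -> mean_prod X).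
Proof.
split.
- by move=> x y [].
- exact: mm_diag_continuous.
- rewrite -[range _]setCK; apply: open_closedC; rewrite openE => -[x y] nxy.
  have xy : 0 < mdist x y.
    by rewrite mdist_gt0; apply/eqP => xy; apply: nxy; exists x => //; rewrite -xy.
  (* A diagonal point (z, z) has mean distance (d(x, z) + d(y, z)) / 2 >= d(x, y) / 2 from (x,
     y). *)
  apply/nbhs_mdistP; exists (mdist x y / 2); first by rewrite divr_gt0.
  move=> q pq [z _ zq]; move: pq; rewrite -{q}zq mdist_mean/=.
  have := metric_triangle x z y; rewrite (metric_sym z y); lra.
- move=> U oU; exists (fst @^-1` U).
    by apply: open_comp => // p _; exact: mean_fst_continuous.
  apply/seteqP; split=> [_ [x Ux <-]|p [+ [x _ xp]]]; first by split=> //; exists x.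
  by rewrite -xp /= => Ux; exists x.
Qed.

(** * Bounds and uniform continuity on compact sets *)

Lemma continuous_compact_le (M : metricType R) (A : set M) (f : M -> R) :
  continuous f -> compact A -> exists B, forall x, A x -> f x <= B.
Proof.
move=> fc cA.
have : compact (f @` A).
  by apply: continuous_compact => //; exact: continuous_subspaceT.
move=> /compact_bounded[B [_ HB]]; exists (B + 1) => x Ax.
have BB : B < B + 1 by rewrite ltrDl.
by rewrite (le_trans (ler_norm _))//; apply: (HB _ BB); exists x.
Qed.

(** Only [x] is confined to [A]. Compactness is used in its near-covering form, the radius being a
    parameter that tends to 0 from the right. *)
Lemma continuous_compact_unif (A : set X) (f : X -> R) (e : R) :
  continuous f -> compact A -> 0 < e -> exists2 d : R, 0 < d &
    forall x y, A x -> mdist x y < d -> `|f y - f x| < e.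
Proof.
move=> fc cA e0; have e2 : 0 < e / 2 by rewrite divr_gt0.
have := (compact_near_coveringP A).1 cA R (0^'+)
  (fun d x => forall y, mdist x y < d -> `|f y - f x| < e) _.
case=> [x Ax|d d0 Hd].
  have [d d0 Hd] := (continuous_mdistP f).1 fc x _ e2.
  exists (ball x (d / 2), [set r | r < d / 2]); first split => /=.
  - by apply: nbhsx_ballx; rewrite divr_gt0.
  - by apply: nbhs_right_lt; rewrite divr_gt0.
  move=> [y r] /= [xy rd] z yz; rewrite ballEmdist/= in xy.
  have := Hd y; have := Hd z; have := metric_triangle x y z.
  move=> tri H1 H2; have {}H1 : `|f z - f x| < e / 2.
    by apply: H1; move: tri xy rd yz; lra.
  have {}H2 : `|f y - f x| < e / 2.
    by apply: H2; have := mdist_ge0 y z; move: xy rd yz; lra.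
  by move: H1 H2; rewrite !ltr_norml; lra.
(* The filter of radii gives all positive values below [d]; one of them has to be chosen. *)
exists (d / 2); first by rewrite divr_gt0.
move=> x y Ax xy; apply: (Hd (d / 2)) => //=; last by rewrite divr_gt0.
rewrite sub0r normrN ger0_norm ?divr_ge0 ?ltW//.
by rewrite ltr_pdivrMr// mulr2n mulrDr mulr1 ltrDl.
Qed.

Lemma path_uniform (eta : R -> X) (e : R) : {within `[0, 1], continuous eta} ->
  0 < e -> exists2 d : R, 0 < d & forall s s', 0 <= s <= 1 -> 0 <= s' <= 1 ->
    `|s - s'| < d -> mdist (eta s) (eta s') < e.
Proof.
move=> /subspace_continuousP etac e0; have e2 : 0 < e / 2 by rewrite divr_gt0.
have := (near_covering_withinP (`[0, 1]%classic : set R)).2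
  ((compact_near_coveringP _).1 (@segment_compact R 0 1)) R (0^'+)
  (fun d s => forall s', 0 <= s' <= 1 -> `|s - s'| < d -> mdist (eta s) (eta s') < e) _.
case=> [s s01|d d0 Hd].
  have /etac/(_ (ball (eta s) (e / 2)))[|d /= d0 Hd] := s01.
    exact: nbhsx_ballx.
  exists (ball s (d / 2), [set r | r < d / 2]); first split => /=.
  - by apply: nbhsx_ballx; rewrite divr_gt0.
  - by apply: nbhs_right_lt; rewrite divr_gt0.
  move=> [s1 r] /= [ss1 rd] s101 s' s'01 s1s'; rewrite /ball/= in ss1.
  have := Hd s1; have := Hd s'; rewrite /= !ballEmdist/= !in_itv/= => H1 H2.
  have := metric_triangle (eta s1) (eta s) (eta s').
  rewrite (metric_sym (eta s1) (eta s)) => tri.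
  have {}H1 : mdist (eta s) (eta s') < e / 2.
    apply: H1 => //; rewrite -(subrK s1 s) -addrA.
    by rewrite (le_lt_trans (ler_normD _ _))//; move: ss1 s1s' rd; lra.
  have {}H2 : mdist (eta s) (eta s1) < e / 2.
    by apply: H2 => //; move: ss1 d0; lra.
  by move: tri H1 H2; lra.
exists (d / 2); first by rewrite divr_gt0.
move=> s s' s01 s'01 ss'; apply: (Hd (d / 2)) => //=; last by rewrite divr_gt0.
rewrite sub0r normrN ger0_norm ?divr_ge0 ?ltW//.
by rewrite ltr_pdivrMr// mulr2n mulrDr mulr1 ltrDl.
Qed.

End Curves.

(** * Cost of chains *)

(* A chain x, s_0, s_1, ... is represented by its starting point x and the list s.
   Its cost omits the summand E - E^M at the last point, so that costs add up
   under concatenation; see [mm_actionE] and [curve_actionE]. *)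
Fixpoint chain_cost (R : realType) (X : metricType R) (E : R -> X -> R)
    (tau t : R) (x : X) (s : seq X) : R :=
  if s is y :: s' then mm_Lag E tau t (x, y) + chain_cost E tau t y s' else 0.

Definition chain_inf (R : realType) (X : metricType R) (E : R -> X -> R)
    (tau t : R) (x y : X) : R :=
  inf [set chain_cost E tau t x s | s in [set s | last x s = y]].

Section MinimizingMovements.
Context {R : realType} {X : metricType R}.
Variables (T : R) (E : R -> X -> R) (tau C K : R).
Implicit Types (t : R) (x y : X).

(* (A3) yields C = C_1 and K = C_2 / C_1, and the transition rule provides the
   minimizers. *)
Hypothesis tau_gt0 : 0 < tau.
Hypothesis C_gt0 : 0 < C.
Hypothesis E_ge : forall t x, 0 <= t <= T -> 0 <= E t x + K.
Hypothesis E_gronwall : forall s t x, 0 <= s <= T -> 0 <= t <= T ->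
  E t x + K <= expR (C * `|t - s|) * (E s x + K).
Hypothesis E_continuous : forall t x (e : R), 0 <= t <= T -> 0 < e ->
  exists2 d : R, 0 < d & forall s y, 0 <= s <= T -> `|t - s| < d ->
    mdist x y < d -> `|E s y - E t x| < e.
Hypothesis argmin_neq0 : forall t x, 0 <= t <= T -> mm_argmin E tau t x !=set0.

(** * The Moreau-Yosida envelope and its joint continuity *)

Local Notation EM := (mm_envelope E tau).
Local Notation c := ((2 * tau)^-1).

Let c_ge0 : 0 <= c. Proof. by rewrite invr_ge0 mulr_ge0// ltW. Qed.

Lemma mm_functional_ge t x y : 0 <= t <= T -> - K <= mm_functional E tau t x y.
Proof.
move=> t0T; have : 0 <= c * mdist y x ^+ 2 by rewrite mulr_ge0 ?sqr_ge0.
by rewrite /mm_functional; have := E_ge y t0T; lra.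
Qed.

Lemma mm_envelope_le t x y : 0 <= t <= T -> EM t x <= E t y + c * mdist y x ^+ 2.
Proof.
move=> t0T; apply: ge_inf; last by exists y.
by exists (- K) => _ [z _ <-]; exact: mm_functional_ge.
Qed.

Lemma mm_envelope_attained t x : 0 <= t <= T ->
  exists y, EM t x = E t y + c * mdist y x ^+ 2.
Proof.
move=> t0T; have [y ymin] := argmin_neq0 x t0T; exists y.
apply/eqP; rewrite eq_le mm_envelope_le//=; apply: lb_le_inf.
  by exists (mm_functional E tau t x y), y.
by move=> _ [z _ <-]; exact: ymin.
Qed.

Lemma mm_envelope_le_energy t x : 0 <= t <= T -> EM t x <= E t x.
Proof.
by move=> /(mm_envelope_le x x); rewrite mdistxx expr0n/= mulr0 addr0.
Qed.

Lemma mm_envelope_ge t x : 0 <= t <= T -> - K <= EM t x.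
Proof.
by move=> t0T; have [y ->] := mm_envelope_attained x t0T; exact: mm_functional_ge.
Qed.

(** A minimizer at (t, x') competes at (s, x): Gronwall controls the change of time, the triangle
    inequality the change of base point. *)
Lemma mm_envelope_near s t x x' (B : R) : 0 <= s <= T -> 0 <= t <= T ->
  E t x' <= B ->
  EM s x <= EM t x' + (expR (C * `|t - s|) - 1) * (B + K)
    + c * (mdist x x' ^+ 2 + 2 * mdist x x' * Num.sqrt (2 * tau * (B + K))).
Proof.
move=> s0T t0T EB; have [y EMy] := mm_envelope_attained x' t0T.
have cd_ge0 : 0 <= c * mdist y x' ^+ 2 by rewrite mulr_ge0 ?sqr_ge0.
have EMB : EM t x' <= B by rewrite (le_trans _ EB)// mm_envelope_le_energy.
have Ey := E_ge y t0T.
set M := Num.sqrt _.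
(* The penalty of the minimizer is [EM t x' - E t y], which is at most B + K because [E t y] is at
   least -K. *)
have yM : mdist y x' <= M.
  rewrite -(ger0_norm (mdist_ge0 y x')) -sqrtr_sqr ler_wsqrtr//.
  rewrite -ler_pdivrMl ?mulr_gt0//; move: EMB Ey; rewrite EMy; lra.
have ex1 : 0 <= expR (C * `|t - s|) - 1.
  by rewrite subr_ge0 -expR0 ler_expR mulr_ge0// ltW.
have : (expR (C * `|t - s|) - 1) * (E t y + K) <= (expR (C * `|t - s|) - 1) * (B + K).
  by rewrite ler_wpM2l// lerD2r; move: EMB; rewrite EMy; lra.
have := E_gronwall y t0T s0T; rewrite (distrC s t).
have : c * mdist y x ^+ 2 <= c * (mdist y x' ^+ 2 + mdist x x' ^+ 2 + 2 * mdist x x' * M).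
  rewrite ler_wpM2l//.
  have D := metric_triangle y x' x; rewrite (metric_sym x' x) in D.
  apply: (@le_trans _ _ ((mdist y x' + mdist x x') ^+ 2)).
    by rewrite lerXn2r ?nnegrE ?addr_ge0 ?mdist_ge0.
  have : mdist x x' * mdist y x' <= mdist x x' * M by rewrite ler_wpM2l ?mdist_ge0.
  by rewrite sqrrD; lra.
have := mm_envelope_le x y s0T; rewrite EMy.
have arith (c' ex es et k b d1 d2 e1 e2 ES : R) :
    ES <= es + c' * d1 -> c' * d1 <= c' * (d2 + e1 + e2) -> es + k <= ex * (et + k) ->
    (ex - 1) * (et + k) <= (ex - 1) * (b + k) ->
    ES <= et + c' * d2 + (ex - 1) * (b + k) + c' * (e1 + e2).
  by lra.
exact: arith.
Qed.

Lemma quadratic_small (M e : R) : 0 < e -> exists2 d : R, 0 < d &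
  forall r : R, `|r| < d -> c * (r ^+ 2 + 2 * r * M) < e.
Proof.
move=> e0.
have : (fun r => c * (r ^+ 2 + 2 * r * M)) @ 0 --> (c * (0 ^+ 2 + 2 * 0 * M)).
  apply: cvgM; first exact: cvg_cst.
  apply: cvgD; first exact: exprn_continuous.
  apply: cvgM; last exact: cvg_cst.
  exact: mulrl_continuous.
rewrite expr0n/= mulr0 mul0r addr0 mulr0 => /cvgrPdist_lt/(_ _ e0)[d /= d0 Hd].
exists d => // r rd; have := Hd r; rewrite /= sub0r normrN => /(_ rd).
by rewrite sub0r normrN; exact/le_lt_trans/ler_norm.
Qed.

Lemma mm_envelope_continuous t x (e : R) : 0 <= t <= T -> 0 < e ->
  exists2 d : R, 0 < d & forall s y, 0 <= s <= T -> `|t - s| < d ->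
    mdist x y < d -> `|EM s y - EM t x| < e.
Proof.
move=> t0T e0; have [d1 d10 Hd1] := E_continuous x t0T ltr01.
(* [B] bounds the energy at (t, x) and at all nearby (s, y), so the one-sided estimate applies in
   both directions with the same [M]. *)
pose B := E t x + 1; pose M := Num.sqrt (2 * tau * (B + K)).
have e2 : 0 < e / 2 by rewrite divr_gt0.
have [d2 d20 Hd2] : exists2 d : R, 0 < d &
    forall r : R, `|r| < d -> (expR (C * r) - 1) * (B + K) < e / 2.
  have : (fun r => (expR (C * r) - 1) * (B + K)) @ 0 --> ((expR (C * 0) - 1) * (B + K)).
    apply: cvgM; last exact: cvg_cst.
    apply: cvgB; last exact: cvg_cst.
    apply: (@continuous_comp _ _ _ ( *%R C) expR); last exact: continuous_expR.
    exact: mulrl_continuous.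
  rewrite mulr0 expR0 subrr mul0r => /cvgrPdist_lt/(_ _ e2)[d /= d0 Hd].
  exists d => // r rd; have := Hd r; rewrite /= sub0r normrN => /(_ rd).
  by rewrite sub0r normrN; exact/le_lt_trans/ler_norm.
have [d3 d30 Hd3] := quadratic_small M e2.
exists (Num.min d1 (Num.min d2 d3)); first by rewrite !lt_min d10 d20.
move=> s y s0T; rewrite !lt_min => /and3P[s1 s2 _] /and3P[y1 _ y3].
have EB : E s y <= B.
  by have := Hd1 s y s0T s1 y1; rewrite ltr_distl => /andP[_ /ltW].
have EB' : E t x <= B by rewrite lerDl.
have := mm_envelope_near y s0T t0T EB'; have := mm_envelope_near x t0T s0T EB.
rewrite (metric_sym y x) (distrC s t).
have := Hd2 `|t - s|; rewrite normr_id => /(_ s2).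
have := Hd3 (mdist x y); rewrite ger0_norm ?mdist_ge0// => /(_ y3).
rewrite ltr_distl -/M.
have arith (a b p q : R) : p < e / 2 -> q < e / 2 -> a <= b + q + p ->
    b <= a + q + p -> a - e < b < a + e.
  by lra.
by move=> h1 h2 h3 h4; exact: arith h1 h2 h3 h4.
Qed.

(** * Elementary properties of the Lagrangian and of chain costs *)

Local Notation ell t x y := (mm_Lag E tau t (x, y)).
Local Notation cost := (chain_cost E tau).
Local Notation cinf := (chain_inf E tau).

Lemma mm_Lag_self t x : ell t x x = E t x - EM t x.
Proof. by rewrite /mm_Lag/= mdistxx expr0n/= mulr0 addr0. Qed.

Lemma mm_Lag_gap t x y : E t x - EM t x <= ell t x y.
Proof. by rewrite /mm_Lag/= lerDl mulr_ge0 ?sqr_ge0. Qed.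

Lemma mm_gap_ge0 t x : 0 <= t <= T -> 0 <= E t x - EM t x.
Proof. by move=> t0T; rewrite subr_ge0 mm_envelope_le_energy. Qed.

Lemma mm_Lag_ge0 t p : 0 <= t <= T -> 0 <= mm_Lag E tau t p.
Proof.
case: p => x y t0T; exact: le_trans (mm_gap_ge0 x t0T) (mm_Lag_gap t x y).
Qed.

Lemma mm_Lag_jump t x y : 0 <= t <= T -> c * mdist x y ^+ 2 <= ell t x y.
Proof. by move=> t0T; rewrite /mm_Lag/= lerDr mm_gap_ge0. Qed.

Lemma mm_Lag_ge t x y : 0 <= t <= T -> E t x - E t y <= ell t x y.
Proof.
move=> t0T; have := mm_envelope_le x y t0T.
by rewrite /mm_Lag/= (metric_sym x); lra.
Qed.

Lemma chain_cost_cat t x s1 s2 :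
  cost t x (s1 ++ s2) = cost t x s1 + cost t (last x s1) s2.
Proof. by elim: s1 x => [x|y s1 IH x]/=; rewrite ?add0r// IH addrA. Qed.

Lemma chain_cost_rcons t x s y :
  cost t x (rcons s y) = cost t x s + ell t (last x s) y.
Proof. by rewrite -cats1 chain_cost_cat/= addr0. Qed.

Lemma chain_cost_ge0 t x s : 0 <= t <= T -> 0 <= cost t x s.
Proof. by move=> t0T; elim: s x => //= y s IH x; rewrite addr_ge0// mm_Lag_ge0. Qed.

Lemma chain_cost_ge t x s : 0 <= t <= T -> E t x - E t (last x s) <= cost t x s.
Proof.
move=> t0T; elim: s x => [x|y s IH x]/=; first by rewrite subrr.
by have := IH y; have := mm_Lag_ge x y t0T; lra.
Qed.

Lemma chain_inf_has_inf t x y : 0 <= t <= T ->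
  has_inf [set cost t x s | s in [set s | last x s = y]].
Proof.
move=> t0T; split; first by exists (cost t x [:: y]), [:: y].
by exists 0 => _ [s _ <-]; exact: chain_cost_ge0.
Qed.

Lemma chain_inf_le t x s : 0 <= t <= T -> cinf t x (last x s) <= cost t x s.
Proof.
move=> t0T; apply: ge_inf; last by exists s.
by case: (chain_inf_has_inf x (last x s) t0T).
Qed.

Lemma chain_inf_lt t x y (a : R) : 0 <= t <= T -> cinf t x y < a ->
  exists2 s, last x s = y & cost t x s < a.
Proof.
move=> t0T /inf_lt[|_ [s xs <-] sa]; first by case: (chain_inf_has_inf x y t0T).
by exists s.
Qed.

Lemma le_chain_inf t x y (a : R) : 0 <= t <= T ->
  (forall s, last x s = y -> a <= cost t x s) -> a <= cinf t x y.
Proof.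
move=> t0T H; apply: lb_le_inf; first by case: (chain_inf_has_inf x y t0T).
by move=> _ [s xs <-]; exact: H.
Qed.

Lemma chain_inf_ge0 t x y : 0 <= t <= T -> 0 <= cinf t x y.
Proof. by move=> t0T; apply: le_chain_inf => // s _; exact: chain_cost_ge0. Qed.

Lemma chain_inf_ge t x y : 0 <= t <= T -> E t x - E t y <= cinf t x y.
Proof. by move=> t0T; apply: le_chain_inf => // s <-; exact: chain_cost_ge. Qed.

Lemma chain_infxx t x : 0 <= t <= T -> cinf t x x = 0.
Proof.
move=> t0T; apply/eqP; rewrite eq_le chain_inf_ge0// andbT.
exact: (chain_inf_le x [::] t0T).
Qed.

Lemma chain_inf_step t x y : 0 <= t <= T -> cinf t x y <= ell t x y.
Proof. by move=> t0T; rewrite -[leRHS]addr0; exact: (chain_inf_le x [:: y] t0T). Qed.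

Lemma chain_inf_triangle t y x z : 0 <= t <= T ->
  cinf t x z <= cinf t x y + cinf t y z.
Proof.
move=> t0T; rewrite -lerBlDr; apply: le_chain_inf => // s1 xs1.
rewrite lerBlDr addrC -lerBlDr; apply: le_chain_inf => // s2 ys2.
rewrite lerBlDr addrC -ys2 -xs1 -last_cat.
by rewrite (le_trans (chain_inf_le _ _ t0T))// chain_cost_cat.
Qed.

(** * Translation of integer-indexed sequences and curves into chains *)

Lemma sum_chain_cost t (w : nat -> X) n :
  \sum_(0 <= k < n) ell t (w k) (w k.+1) = cost t (w 0) (mkseq (w \o succn) n)
  /\ last (w 0) (mkseq (w \o succn) n) = w n.
Proof.
elim: n => [|n [IH wn]]; first by rewrite big_geq.
by rewrite mkseqS last_rcons chain_cost_rcons big_nat_recr//= IH wn.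
Qed.

Lemma chain_cost_sum t x s :
  cost t x s = \sum_(0 <= k < size s) ell t (nth x (x :: s) k) (nth x (x :: s) k.+1).
Proof.
have [-> _] := sum_chain_cost t (nth x (x :: s)) (size s).
by congr chain_cost; rewrite [RHS](mkseq_nth x s).
Qed.

(** The convention u_(b+1) = u_b makes the last summand a Lagrangian on the diagonal; the other
    summands are the cost of a chain. *)
Lemma mm_actionE t x y : 0 <= t <= T ->
  mm_action E tau t x y = cinf t x y + ell t y y.
Proof.
move=> t0T; pose Lag := mm_Lag E tau t.
have LagE u v : Lag (u, v) = E t u - EM t u + c * mdist v u ^+ 2.
  by rewrite /Lag /mm_Lag/= (metric_sym u).
rewrite /mm_action; set A := (X in inf X).
have Achain S : A S -> exists2 s, last x s = y & S = cost t x s + ell t y y.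
  move=> [a [b [u [ab ua ub ub1 ->]]]].
  pose w k := u (a + k%:Z).
  have wn : w `|b - a|%N = u b by rewrite /w gez0_abs ?subr_ge0// subrKC.
  have [wc wl] := sum_chain_cost t w `|b - a|%N.
  have w0 : w 0 = x by rewrite /w addr0.
  rewrite w0 in wc wl.
  exists (mkseq (w \o succn) `|b - a|%N); first by rewrite wl wn.
  rewrite big_nat_recr//=; congr (_ + _).
    rewrite -wc; apply: eq_bigr => k _.
    rewrite -/Lag LagE /w (_ : a + k + 1 = a + k.+1)//.
    by rewrite -addrA addrC intS addrC [1 + _]addrC.
  rewrite -/(w _) -/(Lag _) LagE gez0_abs ?subr_ge0// subrKC ub1 ub.
  by rewrite wn ub.
have chainA s : last x s = y -> A (cost t x s + ell t y y).
  move=> xs; pose w := nth x (x :: s); pose n := size s.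
  have wn : w n = y by rewrite -xs (last_nth x).
  (* Truncation of the index at [n] makes the sequence constant after [b], as the convention for the
     last summand demands. *)
  exists 0, n%:Z, (fun z : int => w (minn `|z| n)); split => //.
  - by rewrite absz0 min0n.
  - by rewrite absz_nat minnn.
  - by rewrite -PoszD absz_nat minnn (minn_idPr _) ?leq_addr.
  rewrite subr0 absz_nat big_nat_recr//= chain_cost_sum; congr (_ + _).
    rewrite -/n; apply: eq_big_nat => k /andP[_ kn].
    rewrite -/(Lag _) LagE add0n addn1.
    by rewrite (minn_idPl kn) (minn_idPl (ltnW kn)).
  rewrite -/(Lag _) LagE add0n minnn.
  by rewrite (minn_idPr _) ?leq_addr// wn.
apply/eqP; rewrite eq_le; apply/andP; split.
  rewrite -lerBlDr; apply: le_chain_inf => // s xs; rewrite lerBlDr.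
  apply: ge_inf; last exact: chainA.
  exists 0 => S /Achain[s' _ ->].
  by rewrite addr_ge0 ?chain_cost_ge0 ?mm_Lag_ge0.
apply: lb_le_inf; first by exists (cost t x [:: y] + ell t y y); exact: chainA.
by move=> S /Achain[s <- ->]; rewrite lerD2r chain_inf_le.
Qed.

(** The sum over a curve starts after its initial pair: it charges the jumps from [p.2] to [q.1] and
    then the final pair [q]. The second clause locates the curve, for the compactness property. *)
Lemma curve_of_chain (p q : mean_prod X) (s : seq X) : last p.2 s = q.1 ->
  exists g, [/\ mm_curves p q g,
    forall z, start g <= z <= stop g ->
      (pos g z).1 \in [:: p.1, p.2, q.2 & s] /\
      (pos g z).2 \in [:: p.1, p.2, q.2 & s] &
    forall t, curve_integral (mm_Lag E tau t) g
      = (cost t p.2 s + mm_Lag E tau t q)%:E].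
Proof.
move=> ps.
(* g runs through the consecutive pairs of the list v *)
pose v := p.1 :: p.2 :: rcons s q.2; pose n := size s.
pose w := nth p.1 v.
have w_last : w n.+1 = q.1.
  by rewrite /w/= -rcons_cons nth_rcons/= ltnS leqnn -ps (last_nth p.1).
have w_end : w n.+2 = q.2 by rewrite /w/= nth_rcons ltnn eqxx.
pose g : curve int (mean_prod X) :=
  Curve 0 n.+1%:Z (fun z : int => (w `|z|%N, w `|z|.+1)).
exists g; split.
- split => //=; first exact/esym/surjective_pairing.
    by rewrite w_last w_end; exact/esym/surjective_pairing.
  move=> z /andP[z0 _]; congr w.
  by case: z z0 => // k _; rewrite -PoszD absz_nat addn1.
- move=> z /= /andP[z0 zn].
  have wv k : (k <= n.+2)%N -> w k \in [:: p.1, p.2, q.2 & s].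
    move=> kn; have : w k \in v by rewrite mem_nth//= size_rcons !ltnS.
    rewrite !inE mem_rcons !inE => /or3P[->|->|->]; rewrite ?orbT//.
  have zn' : (`|z| <= n.+1)%N by case: z z0 zn.
  by split; apply: wv => //; exact: leqW.
- move=> t; rewrite /curve_integral; congr EFin.
  have -> : `|stop g - start g|%N = n.+1 by rewrite [stop _]/= [start _]/= subr0.
  rewrite big_add1 (eq_bigr (fun k => ell t (w k.+1) (w k.+2)))//.
  rewrite [X in \sum_(_ <= _ < X) _]/= big_nat_recr//= w_last w_end.
  rewrite -surjective_pairing; congr (_ + _).
  rewrite chain_cost_sum; apply: eq_big_nat => k /andP[_ kn].
  have wj j : (j <= n)%N -> w j.+1 = nth p.2 (p.2 :: s) j.
    move=> jn; rewrite /w/v [LHS]/= -rcons_cons nth_rcons [size _]/= ltnS jn.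
    by rewrite (set_nth_default p.2).
  by rewrite !wj// ltnW.
Qed.

Lemma chain_of_curve (p q : mean_prod X) g : mm_curves p q g ->
  exists2 s, last p.2 s = q.1 &
    forall t, curve_integral (mm_Lag E tau t) g
      = (cost t p.2 s + mm_Lag E tau t q)%:E.
Proof.
case: g => a b w [/= ab wa wb w12].
(* The strict inequality a < b gives n + 1 summands: [n] jumps of the chain and the final pair. *)
have [n bE] : exists n : nat, b = a + n.+1%:Z.
  exists `|b - a|.-1%N; rewrite prednK ?absz_gt0 ?subr_eq0 ?gt_eqF//.
  by rewrite gez0_abs ?subr_ge0 ?ltW// subrKC.
pose v k := (w (a + k.+1%:Z)).1.
have v12 k : (k <= n)%N -> (w (a + k%:Z)).2 = v k.
  move=> kn; rewrite w12; first by rewrite /v -addrA -PoszD addn1.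
  by rewrite lerDl/= bE -addrA lerD2l intS addrC addKr lez_nat.
have v0 : v 0 = p.2 by rewrite -v12// addr0 wa.
have vn : v n = q.1 by rewrite /v -bE wb.
exists (mkseq (v \o succn) n); first by rewrite -v0 -vn; case: (sum_chain_cost 0 v n).
move=> t; rewrite /curve_integral; congr EFin.
have -> : `|stop (Curve a b w) - start (Curve a b w)|%N = n.+1.
  by rewrite [stop _]/= [start _]/= bE addrC addKr.
rewrite -v0 -(sum_chain_cost t v n).1 big_add1 [X in \sum_(_ <= _ < X) _]/=.
rewrite big_nat_recr//= -bE wb; congr (_ + _); apply: eq_big_nat => k /andP[_ kn].
by rewrite -(v12 k.+1)// /v -surjective_pairing.
Qed.

(** On diagonal pairs the right-hand side is that of [mm_actionE], so the action is the one
    generated by the curves. *)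
Lemma curve_actionE t (p q : mean_prod X) : 0 <= t <= T ->
  curve_action (@mm_curves R X) (mm_Lag E tau t) p q
    = (cinf t p.2 q.1 + mm_Lag E tau t q)%:E.
Proof.
move=> t0T; apply/eqP; rewrite eq_le; apply/andP; split.
  apply/lee_addgt0Pr => e e0.
  have [|s xs sa] := @chain_inf_lt t p.2 q.1 (cinf t p.2 q.1 + e) t0T.
    by rewrite ltrDl.
  have [g [gpq _ gs]] := curve_of_chain xs.
  apply: (@le_trans _ _ (curve_integral (mm_Lag E tau t) g)).
    by apply: ereal_inf_lbound; exists g.
  by rewrite gs -!EFinD lee_fin addrAC lerD2r ltW.
apply: le_ereal_inf_tmp => _ [g gpq <-].
have [s <- ->] := chain_of_curve gpq.
by rewrite lee_fin lerD2r chain_inf_le.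
Qed.

(** * Lower semicontinuity of the action *)

Local Notation gap t x := (E t x - EM t x).

Lemma mm_gap_continuous t x (e : R) : 0 <= t <= T -> 0 < e ->
  exists2 d : R, 0 < d & forall s y, 0 <= s <= T -> `|t - s| < d ->
    mdist x y < d -> `|gap s y - gap t x| < e.
Proof.
move=> t0T e0; have e2 : 0 < e / 2 by rewrite divr_gt0.
have [d1 d10 Hd1] := E_continuous x t0T e2.
have [d2 d20 Hd2] := mm_envelope_continuous x t0T e2.
exists (Num.min d1 d2); first by rewrite lt_min d10.
move=> s y s0T; rewrite !lt_min => /andP[s1 s2] /andP[y1 y2].
have := Hd1 s y s0T s1 y1; have := Hd2 s y s0T s2 y2.
by rewrite !ltr_norml; lra.
Qed.

Lemma mm_jump_le t x y (a : R) : 0 <= t <= T -> ell t x y <= a ->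
  mdist x y <= Num.sqrt (2 * tau * a).
Proof.
move=> t0T /(le_trans (mm_Lag_jump x y t0T)) ca.
rewrite -(ger0_norm (mdist_ge0 x y)) -sqrtr_sqr ler_wsqrtr//.
by rewrite -ler_pdivrMl ?mulr_gt0.
Qed.

Lemma mdist_sqr_le x y z (M : R) : mdist y z <= M ->
  mdist x z ^+ 2 <= mdist y z ^+ 2 + (mdist x y ^+ 2 + 2 * mdist x y * M).
Proof.
move=> yzM; apply: (@le_trans _ _ ((mdist x y + mdist y z) ^+ 2)).
  by rewrite lerXn2r ?nnegrE ?addr_ge0 ?mdist_ge0 ?metric_triangle.
have : mdist x y * mdist y z <= mdist x y * M by rewrite ler_wpM2l ?mdist_ge0.
by rewrite sqrrD; lra.
Qed.

(* Moving an endpoint of a chain changes only the jump at that end, whose length is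
   bounded in terms of the cost.  This needs at least one jump: the trivial chain
   from x to itself is free. *)
Lemma chain_inf_move_start t x y z (a : R) : 0 <= t <= T -> y != z ->
  cinf t y z < a -> cinf t x z <= a + gap t x - gap t y
    + c * (mdist x y ^+ 2 + 2 * mdist x y * Num.sqrt (2 * tau * a)).
Proof.
move=> t0T yz /chain_inf_lt[//|[|w s]/= ws]; first by rewrite ws eqxx in yz.
move=> sa; have := chain_inf_le x (w :: s) t0T; rewrite /= ws.
have := chain_cost_ge0 w s t0T => s0.
have yw : mdist y w <= Num.sqrt (2 * tau * a).
  by apply: (mm_jump_le t0T); move: s0 sa; lra.
have := ler_wpM2l c_ge0 (mdist_sqr_le x yw).
by move: sa; rewrite /mm_Lag/=; lra.
Qed.

Lemma chain_inf_move_end t x y z (a : R) : 0 <= t <= T -> x != y ->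
  cinf t x y < a -> cinf t x z <= a
    + c * (mdist z y ^+ 2 + 2 * mdist z y * Num.sqrt (2 * tau * a)).
Proof.
move=> t0T xy /chain_inf_lt[//|s]; case/lastP: s => [|s w]/= ws.
  by rewrite ws eqxx in xy.
rewrite last_rcons in ws; rewrite ws chain_cost_rcons => sa.
have := chain_inf_le x (rcons s z) t0T; rewrite last_rcons chain_cost_rcons.
have := chain_cost_ge0 x s t0T => s0.
have yw : mdist y (last x s) <= Num.sqrt (2 * tau * a).
  by rewrite metric_sym; apply: (mm_jump_le t0T); move: s0 sa; lra.
have := ler_wpM2l c_ge0 (mdist_sqr_le z yw).
rewrite !(metric_sym _ (last x s)).
by move: sa; rewrite /mm_Lag/=; lra.
Qed.

(** For distinct endpoints, a cheap chain between nearby points is moved to the given endpoints one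
    end at a time. For equal endpoints the chain part is 0 at the limit, and the continuity of the
    gap suffices. *)
Lemma mm_action_lsc t : 0 <= t <= T ->
  lower_semicontinuous (fun q : X * X => (mm_action E tau t q.1 q.2)%:E).
Proof.
move=> t0T [x1 x2] a /=; rewrite lte_fin mm_actionE// mm_Lag_self => ax.
suff [d d0 Hd] : exists2 d : R, 0 < d & forall y1 y2,
    mdist x1 y1 < d -> mdist x2 y2 < d -> a < mm_action E tau t y1 y2.
  exists [set q | mdist x1 q.1 < d /\ mdist x2 q.2 < d].
    exists (ball x1 d, ball x2 d); first by split; exact: nbhsx_ballx.
    by move=> [y1 y2] /= []; rewrite !ballEmdist.
  by move=> [y1 y2] /= [y1d y2d]; rewrite lte_fin Hd.
have gap_near (e : R) : 0 < e -> exists2 d : R, 0 < d & forall x y,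
    (x = x1 \/ x = x2) -> mdist x y < d -> `|gap t y - gap t x| < e.
  move=> e0; have [d1 d10 Hd1] := mm_gap_continuous x1 t0T e0.
  have [d2 d20 Hd2] := mm_gap_continuous x2 t0T e0.
  exists (Num.min d1 d2) => [|x y]; first by rewrite lt_min d10.
  by rewrite lt_min => -[->|->] /andP[? ?]; [apply: Hd1|apply: Hd2];
    rewrite ?subrr ?normr0.
have [x12|x12] := eqVneq x1 x2.
  rewrite {}x12 chain_infxx// add0r in gap_near ax.
  have e0 : 0 < gap t x2 - a by rewrite subr_gt0.
  have [d d0 Hd] := gap_near _ e0; exists d => // y1 y2 _ y2d.
  have := Hd x2 y2 (or_intror erefl) y2d; have := chain_inf_ge0 y1 y2 t0T.
  by rewrite mm_actionE// mm_Lag_self ltr_norml; lra.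
(* Moving the start costs 3e, moving the end 2e, and comparing the gaps at [x2] and [y2] one more e:
   6e in all, less than the margin 7e. *)
pose e := Num.min 1 ((cinf t x1 x2 + gap t x2 - a) / 7).
have e0 : 0 < e by rewrite lt_min ltr01 divr_gt0// subr_gt0.
have e1 : e <= 1 by rewrite ge_min lexx.
have ea : 7 * e <= cinf t x1 x2 + gap t x2 - a.
  by rewrite mulrC -ler_pdivlMr// ge_min lexx orbT.
have [d1 d10 Hd1] := gap_near e e0.
(* Both chains that are moved cost at most a + 4e, and e <= 1. *)
pose M := Num.sqrt (2 * tau * (`|a| + 4)).
have [d2 d20 Hd2] := quadratic_small M e0.
have D0 : 0 < mdist x1 x2 by rewrite mdist_gt0.
(* The first bound keeps [y2] distinct from [x1] and [y1], so that the chains to be moved have a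
   jump. *)
pose d := Num.min (mdist x1 x2 / 2) (Num.min d1 d2).
exists d; first by rewrite !lt_min divr_gt0// d10.
move=> y1 y2; rewrite !lt_min => /and3P[y1D y11 y12] /and3P[y2D y21 y22].
rewrite ltNge; apply/negP; rewrite mm_actionE// mm_Lag_self => ya.
have tri := metric_triangle x1 y2 x2; rewrite (metric_sym y2) in tri.
have x1y2 : x1 != y2.
  rewrite -mdist_gt0; move: tri y2D D0; lra.
have y1y2 : y1 != y2.
  have := metric_triangle x1 y1 y2; rewrite -mdist_gt0.
  by move: tri y2D y1D; lra.
have gy2 := mm_gap_ge0 y2 t0T; have aN := ler_norm a.
have small x y b : mdist x y < d2 -> b <= `|a| + 4 ->
    c * (mdist x y ^+ 2 + 2 * mdist x y * Num.sqrt (2 * tau * b)) < e.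
  move=> xy ba; apply: le_lt_trans (Hd2 (mdist x y) _); last first.
    by rewrite ger0_norm ?mdist_ge0.
  rewrite ler_wpM2l// lerD2l ler_wpM2l ?mulr_ge0 ?mdist_ge0//.
  by rewrite ler_wsqrtr// ler_pM2l// mulr_gt0.
have := @chain_inf_move_start t x1 y1 y2 (cinf t y1 y2 + e) t0T y1y2.
rewrite ltrDl => /(_ e0).
have := @small x1 y1 (cinf t y1 y2 + e) y12.
have -> : cinf t y1 y2 + e <= `|a| + 4 by move: ya gy2 aN e1; lra.
move=> /(_ isT) E1 step1.
have := Hd1 x1 y1 (or_introl erefl) y11; rewrite ltr_norml => /andP[E2 _].
have := Hd1 x2 y2 (or_intror erefl) y21; rewrite ltr_norml => /andP[E3 _].
have x1y2c : cinf t x1 y2 <= cinf t y1 y2 + 3 * e.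
  by move: E1 E2 step1; lra.
have := @chain_inf_move_end t x1 y2 x2 (cinf t x1 y2 + e) t0T x1y2.
rewrite ltrDl => /(_ e0).
have := @small x2 y2 (cinf t x1 y2 + e) y22.
have -> : cinf t x1 y2 + e <= `|a| + 4 by move: x1y2c ya gy2 aN e1; lra.
by move=> /(_ isT) E4 step2; move: step2 E4 E3 x1y2c ya ea e0; lra.
Qed.

Lemma mm_action_is_action : is_action T E (mm_action E tau).
Proof.
move=> t t0T; split; last 1 first.
- move=> x y; rewrite mm_actionE//.
  by rewrite (le_trans (chain_inf_ge x y t0T))// lerDl mm_Lag_ge0.
- by move=> x y; rewrite mm_actionE// addr_ge0 ?chain_inf_ge0 ?mm_Lag_ge0.
- exact: mm_action_lsc.
Qed.

(** * Compatibility with the transition rule *)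

Lemma mm_action_compatible omega : mm_transition_rule T E tau omega ->
  compatible T E (mm_action E tau) omega.
Proof.
move=> omega_rule t x t0T; have [u [u0 umin uomega]] := omega_rule t x t0T.
set w := omega t x in uomega *.
have ellu n : ell t (u n) (u n.+1) = E t (u n) - E t (u n.+1).
  have EMu : EM t (u n) = E t (u n.+1) + c * mdist (u n.+1) (u n) ^+ 2.
    apply/eqP; rewrite eq_le mm_envelope_le//=.
    by have [y ->] := mm_envelope_attained (u n) t0T; exact: umin.
  by rewrite /mm_Lag/= EMu (metric_sym (u n.+1)); lra.
have Eu m n : (m <= n)%N -> E t (u n) <= E t (u m).
  move=> /subnK <-; elim: (n - m)%N => // k; rewrite addSn; apply: le_trans.
  by rewrite -subr_ge0 -ellu mm_Lag_ge0.
have cu n : cinf t x (u n) <= E t x - E t (u n).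
  elim: n => [|n IH]; first by rewrite u0 chain_infxx// subrr.
  have := chain_inf_triangle (u n) x (u n.+1) t0T.
  by have := chain_inf_step (u n) (u n.+1) t0T; rewrite ellu; move: IH; lra.
(* The gap at [u n] is at most the energy drop of the next step, and the energies decrease and are
   bounded below by -K. *)
have Etail (e : R) : 0 < e -> exists N, forall n, (N <= n)%N -> gap t (u n) < e.
  move=> e0; have infE : has_inf (range (E t \o u)).
    split; first by exists (E t (u 0)), 0.
    by exists (- K) => _ [n _ <-]; have := E_ge (u n) t0T; rewrite /=; lra.
  have [_ [N _ <-] /= HN] := inf_adherent e0 infE.
  exists N => n Nn; have := mm_Lag_gap t (u n) (u n.+1); rewrite ellu.
  have : inf (range (E t \o u)) <= E t (u n.+1).
    by apply: ge_inf; [case: infE|exists n.+1].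
  by have := Eu N n Nn; move: HN; lra.
have close (e : R) : 0 < e -> exists n,
    [/\ gap t (u n) < e, gap t w < gap t (u n) + e, E t w < E t (u n) + e &
      c * mdist (u n) w ^+ 2 < e].
  move=> e0; have [N HN] := Etail e e0.
  have [d1 d10 Hd1] := mm_gap_continuous w t0T e0.
  have [d2 d20 Hd2] := E_continuous w t0T e0.
  have [d3 d30 Hd3] := quadratic_small 0 e0.
  pose d := Num.min d1 (Num.min d2 d3).
  have d0 : 0 < d by rewrite !lt_min d10 d20.
  (* Every tail of the sequence meets every ball around the cluster point. *)
  have [||_ [[n Nn <-]]] := uomega (u @` [set n | (N <= n)%N]) (ball w d).
  - by exists N => // n /= Nn; exists n.
  - exact: nbhsx_ballx.
  rewrite ballEmdist /= !lt_min => /and3P[n1 n2 n3]; exists n.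
  have := Hd1 t (u n) t0T; rewrite subrr normr0 => /(_ d10 n1).
  have := Hd2 t (u n) t0T; rewrite subrr normr0 => /(_ d20 n2).
  have := Hd3 (mdist w (u n)); rewrite ger0_norm ?mdist_ge0// => /(_ n3).
  rewrite mulr0 addr0 (metric_sym w) !ltr_norml => H1 H2 H3.
  by split => //; [exact: HN|move: H3; lra|move: H2; lra].
have gw : gap t w = 0.
  apply/eqP; rewrite eq_le mm_gap_ge0// andbT; apply/ler_addgt0Pl => e e0.
  have [n [h1 h2 _ _]] := close (e / 2) (divr_gt0 e0 (ltr0n _ 2)).
  by move: h1 h2; lra.
rewrite mm_actionE// mm_Lag_self gw addr0; apply/eqP; rewrite eq_le chain_inf_ge//=.
apply/ler_addgt0Pl => e e0.
(* The chain goes from [x] to [u n] and jumps to [w]. The gap at [u n], the jump and the energy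
   difference take e / 3 each. *)
have [n [h1 _ h2 h3]] := close (e / 3) (divr_gt0 e0 (ltr0n _ 3)).
have := chain_inf_triangle (u n) x w t0T; have := cu n.
by have := chain_inf_step (u n) w t0T; rewrite /mm_Lag/=; move: h1 h2 h3; lra.
Qed.

(** * Continuity and zeros of the Lagrangian *)

Lemma jump_continuous : continuous (fun p : mean_prod X => c * mdist p.1 p.2 ^+ 2).
Proof.
have dc : continuous (fun p : mean_prod X => mdist p.1 p.2).
  apply/continuous_mdistP => p1 d d0; exists (d / 2); first by rewrite divr_gt0.
  move=> p2; rewrite mdist_mean ltr_norml.
  have := metric_triangle p1.1 p2.1 p1.2; have := metric_triangle p2.1 p2.2 p1.2.
  have := metric_triangle p2.1 p1.1 p2.2; have := metric_triangle p1.1 p1.2 p2.2.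
  by rewrite (metric_sym p2.1 p1.1) (metric_sym p2.2 p1.2); lra.
by move=> q; exact: (cvgM (cvg_cst c) (cvgM (dc q) (dc q))).
Qed.

Lemma mm_Lag_continuous : {within [set: mean_prod X] `*` `[0, T],
  continuous (fun q : mean_prod X * R => mm_Lag E tau q.2 q.1)}.
Proof.
apply/within_continuousP => -[p t] e [_ /=]; rewrite in_itv/= => t0T e0.
have e2 : 0 < e / 2 by rewrite divr_gt0.
have [d1 d10 Hd1] := (continuous_mdistP _).1 jump_continuous p _ e2.
have [d2 d20 Hd2] := mm_gap_continuous p.1 t0T e2.
exists (Num.min d1 (d2 / 2)); first by rewrite lt_min d10 divr_gt0.
move=> [q s] [_ /=]; rewrite in_itv/= => s0T [/=].
rewrite ballEmdist/= lt_min => /andP[pq1 pq2].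
rewrite /ball/= lt_min => /andP[_ ts].
have pq : mdist p.1 q.1 < d2 by have := mdist_mean_fst p q; move: pq2; lra.
have ts2 : `|t - s| < d2 by move: ts; lra.
have := Hd1 q pq1; have := Hd2 s q.1 s0T ts2 pq; rewrite /mm_Lag !ltr_norml; lra.
Qed.

Lemma gap_crit t x : 0 <= t <= T -> gap t x = 0 -> Crit E t x.
Proof.
move=> t0T /eqP; rewrite subr_eq0 => /eqP gx; apply: (@slope0_quadratic _ _ _ _ c) => y.
by have := mm_envelope_le x y t0T; rewrite (metric_sym x) -gx; lra.
Qed.

Lemma crit_gap (L : R) t x : @path_space R X -> regular_energy T E -> 0 < L ->
  lipschitz_slope T E L -> tau <= 1 / L -> 0 <= t <= T ->
  Crit E t x -> gap t x = 0.
Proof.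
move=> ps Ereg L0 lip tauL t0T cx; apply/eqP; rewrite eq_le mm_gap_ge0// andbT.
have [y ->] := mm_envelope_attained x t0T.
have Et_cont := energy_continuous Ereg t0T.
have sfin z : slope (E t) z \is a fin_num by case: Ereg => _ _ _ + _; apply.
have lip_t z z' := lip t z z' t0T.
have := slope_lipschitz_quadratic y ps Et_cont (ltW L0) sfin lip_t cx.
(* Equivalent to tau <= 1 / L: the penalty outweighs the possible quadratic loss of energy around a
   critical point. *)
have : L / 2 <= c.
  rewrite invfM mulrC ler_pM2l ?invr_gt0//.
  by rewrite -[L]invrK lef_pV2 ?posrE ?invr_gt0// -[L^-1]mul1r.
move=> /(ler_wpM2r (sqr_ge0 (mdist x y))).
by rewrite (metric_sym y); lra.
Qed.

Lemma mm_Lag_eq0 t p : 0 <= t <= T ->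
  mm_Lag E tau t p = 0 <-> gap t p.1 = 0 /\ p = mm_diag p.1.
Proof.
case: p => x y t0T; split=> [Lp|[gx [yx]]]; last by rewrite yx mm_Lag_self.
have gx : gap t x = 0.
  by apply/eqP; rewrite eq_le mm_gap_ge0// andbT -Lp mm_Lag_gap.
split=> //; congr (_, _); apply/esym/mdist_positivity/eqP.
move: Lp; rewrite /mm_Lag/= gx add0r => /eqP.
by rewrite mulf_eq0 invr_eq0 mulf_eq0 pnatr_eq0/= gt_eqF//= sqrf_eq0.
Qed.

(** * Compactness and local smallness of the curve action *)

Lemma energy_le_gronwall s t x (B : R) : 0 <= s <= T -> 0 <= t <= T ->
  E s x <= B -> E t x <= expR (C * T) * (B + K) - K.
Proof.
move=> s0T t0T EB; rewrite lerBrDr (le_trans (E_gronwall x s0T t0T))//.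
have Es := E_ge x s0T.
apply: (@le_trans _ _ (expR (C * T) * (E s x + K))).
  rewrite ler_wpM2r// ler_expR ler_pM2l// ler_norml.
  by move: s0T t0T => /andP[? ?] /andP[? ?]; lra.
by rewrite ler_wpM2l ?expR_ge0// lerD2r.
Qed.

(** A bound on the energy at one time bounds its absolute value at all times, above by Gronwall and
    below by -K. Hence [S] serves all times. *)
Lemma sublevel_compact (B : R) : compact_sublevels T E ->
  exists2 S : set X, compact S & forall t x, 0 <= t <= T -> E t x <= B -> S x.
Proof.
move=> Ecpt; pose B' := `|K| + `|expR (C * T) * (B + K) - K|.
exists [set x | (ereal_sup [set `|E t x|%:E | t in `[0%R, T]] <= B'%:E)%E].
  exact: Ecpt.
move=> t x t0T EB /=; apply: ge_ereal_sup => _ [s /= + <-].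
rewrite in_itv/= => s0T; rewrite lee_fin ler_norml.
have := energy_le_gronwall t0T s0T EB; have := E_ge x s0T.
have := ler_norm K; have := ler_norm (expR (C * T) * (B + K) - K).
have := normr_ge0 K; have := normr_ge0 (expR (C * T) * (B + K) - K).
by rewrite /B'; lra.
Qed.

(** The part of the chain after [z] costs at least the energy drop from [z] to the end. *)
Lemma chain_energy_le t x s z : 0 <= t <= T -> z \in s ->
  E t z <= E t (last x s) + cost t x s.
Proof.
move=> t0T; elim: s x => //= y s IH x.
have := mm_Lag_ge0 (x, y) t0T.
rewrite inE => l0 /orP[/eqP ->|/(IH y)]; last by move: l0; lra.
by have := chain_cost_ge y s t0T; move: l0; lra.
Qed.

Lemma chain_gap_le t x s : 0 <= t <= T ->
  gap t x <= gap t (last x s) + cost t x s.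
Proof.
move=> t0T; case: s => [|y s]/=; first by rewrite addr0.
have := mm_gap_ge0 (last y s) t0T; have := chain_cost_ge0 y s t0T.
by have := mm_Lag_gap t x y; lra.
Qed.

Lemma mm_gap_space_continuous t : 0 <= t <= T -> continuous (fun x => gap t x).
Proof.
move=> t0T; apply/continuous_mdistP => x e e0.
have [d d0 Hd] := mm_gap_continuous x t0T e0; exists d => // y xy.
by apply: Hd; rewrite ?subrr ?normr0.
Qed.

Lemma energy_space_continuous t : 0 <= t <= T -> continuous (E t).
Proof.
move=> t0T; apply/continuous_mdistP => x e e0.
have [d d0 Hd] := E_continuous x t0T e0; exists d => // y xy.
by apply: Hd; rewrite ?subrr ?normr0.
Qed.

Lemma proj_compact (A : set (mean_prod X)) : compact A ->
  exists2 B : set X, compact B & forall p, A p -> B p.1 /\ B p.2.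
Proof.
move=> cA; exists (fst @` A `|` snd @` A).
  apply: compactU; apply: continuous_compact => //; apply: continuous_subspaceT.
    exact: mean_fst_continuous.
  exact: mean_snd_continuous.
by move=> p Ap; split; [left; exists p|right; exists p].
Qed.

(** An almost optimal chain costs little more than the direct jump from [p.2] to [q.1], so its
    points lie in one energy sublevel, whatever the time. *)
Lemma mm_curves_compact (A : set (mean_prod X)) : 0 <= T ->
  compact_sublevels T E -> compact A ->
  exists2 A' : set (mean_prod X), compact A' &
    forall t p q (e : R), 0 <= t <= T -> A p -> A q -> 0 < e ->
      exists g, [/\ mm_curves p q g,
        forall s, start g <= s <= stop g -> A' (pos g s) &
        (curve_integral (mm_Lag E tau t) g
          <= curve_action (@mm_curves R X) (mm_Lag E tau t) p q + e%:E)%E].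
Proof.
move=> T0 Ecpt cA.
have [B cB AB] := proj_compact cA.
have T00 : 0 <= (0 : R) <= T by rewrite lexx.
have [B0 HB0] := continuous_compact_le (energy_space_continuous T00) cB.
have [D HD] : exists D, forall x y, B x -> B y -> c * mdist x y ^+ 2 <= D.
  have fc : continuous (fun p : mean_prod X => c * mdist p.1 p.2 ^+ 2).
    exact: jump_continuous.
  have [D HD] := continuous_compact_le fc (mean_prod_compact cB).
  by exists D => x y Bx By; exact: (HD (x, y)).
pose B1 := expR (C * T) * (B0 + K) - K.
have EB1 t x : 0 <= t <= T -> B x -> E t x <= B1.
  by move=> t0T /HB0; exact: energy_le_gronwall.
(* The inner sum bounds the cost: B1 + K for the gap at [p.2], [|D|] for the direct jump, 1 for the
   slack [e']. The outer [B1] bounds the energy at the end. *)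
have [S cS HS] := sublevel_compact (B1 + (B1 + K + `|D| + 1)) Ecpt.
exists [set p | S p.1 /\ S p.2]; first exact: mean_prod_compact.
move=> t p q e t0T Ap Aq e0.
have [Bp1 Bp2] := AB _ Ap; have [Bq1 Bq2] := AB _ Aq.
pose e' := Num.min e 1.
have e'0 : 0 < e' by rewrite lt_min e0 ltr01.
have [|s ps s_lt] := @chain_inf_lt t p.2 q.1 (cinf t p.2 q.1 + e') t0T.
  by rewrite ltrDl.
have EKx x : 0 <= E t x + K by exact: E_ge.
have cost_le : cost t p.2 s <= B1 + K + `|D| + 1.
  have := chain_inf_step p.2 q.1 t0T; have := HD _ _ Bp2 Bq1.
  have := mm_envelope_ge p.2 t0T; have := EB1 _ _ t0T Bp2; have := ler_norm D.
  have e'1 : e' <= 1 by rewrite ge_min lexx orbT.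
  by move: s_lt e'1; rewrite /mm_Lag/=; lra.
have [g [gpq gS gI]] := curve_of_chain ps.
have inS z : z \in [:: p.1, p.2, q.2 & s] -> S z.
  move=> zs; apply: (HS t) => //.
  have cost0 := chain_cost_ge0 p.2 s t0T.
  have := EB1 _ _ t0T Bq1.
  move: zs; rewrite !inE => /or4P[/eqP->|/eqP->|/eqP->|zs].
  - by have := EB1 _ _ t0T Bp1; move: cost0 cost_le; lra.
  - by have := EB1 _ _ t0T Bp2; move: cost0 cost_le; lra.
  - by have := EB1 _ _ t0T Bq2; move: cost0 cost_le; lra.
  - by have := chain_energy_le p.2 t0T zs; rewrite ps; move: cost0 cost_le; lra.
exists g; split => //.
  by move=> z /gS[z1 z2]; split; exact: inS.
rewrite gI curve_actionE// -EFinD lee_fin addrAC lerD2r.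
have e'e : e' <= e by rewrite ge_min lexx.
by rewrite (le_trans (ltW s_lt))// lerD2l.
Qed.

(** The direct jump from [p.2] to [q.1] is short, since small Lagrangian brings [p.2] close to
    [p.1]. *)
Lemma mm_curves_local t (A : set (mean_prod X)) (e : R) : 0 <= t <= T ->
  compact A -> 0 < e -> exists L' D : R, [/\ 0 < L', 0 < D &
    forall p q, A p -> A q -> mm_Lag E tau t p <= D -> mm_Lag E tau t q <= D ->
      mdist p q <= L' ->
      (curve_action (@mm_curves R X) (mm_Lag E tau t) p q <= e%:E)%E].
Proof.
move=> t0T cA e0; have [B cB AB] := proj_compact cA.
have e4 : 0 < e / 4 by rewrite divr_gt0.
have [d1 d10 Hd1] := continuous_compact_unif (mm_gap_space_continuous t0T) cB e4.
have [d2 d20 Hd2] := quadratic_small 0 e4.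
pose d := Num.min d1 d2 / 2.
have d0 : 0 < d by rewrite divr_gt0// lt_min d10.
have dd1 : d < d1.
  have : Num.min d1 d2 <= d1 by rewrite ge_min lexx.
  by rewrite /d; move: d10; lra.
have dd2 : d < d2.
  have : Num.min d1 d2 <= d2 by rewrite ge_min lexx orbT.
  by rewrite /d; move: d20; lra.
have c_gt0 : 0 < c by rewrite invr_gt0 mulr_gt0.
(* Four contributions of at most e / 4 each: the gap at [p.1], its change up to [p.2], the jump, and
   the Lagrangian at [q]. The second bound forces [mdist p.1 p.2 <= d / 2]. *)
pose D := Num.min (e / 4) (c * (d / 2) ^+ 2).
have D0 : 0 < D by rewrite lt_min e4 mulr_gt0// exprn_gt0// divr_gt0.
exists (d / 8), D; split=> //; first by rewrite divr_gt0.
move=> p q Ap Aq pD qD pq.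
have [Bp1 Bp2] := AB _ Ap.
have De : D <= e / 4 by rewrite ge_min lexx.
have p12 : mdist p.1 p.2 <= d / 2.
  have Dd : D <= c * (d / 2) ^+ 2 by rewrite ge_min lexx orbT.
  have := le_trans (mm_Lag_jump p.1 p.2 t0T) (le_trans _ Dd).
  rewrite -surjective_pairing => /(_ pD); rewrite ler_pM2l//.
  have dh : 0 <= d / 2 := ltW (divr_gt0 d0 (ltr0n _ 2)).
  by rewrite ler_pXn2r ?nnegrE ?mdist_ge0.
have pq12 : mdist p.2 q.1 <= d.
  have := metric_triangle p.2 p.1 q.1; rewrite (metric_sym p.2 p.1).
  by have := mdist_mean_fst p q; move: d0 pq p12; lra.
have := Hd1 p.1 p.2 Bp1 (le_lt_trans (le_trans p12 _) dd1).
have -> : d / 2 <= d by move: d0; lra.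
move=> /(_ isT); rewrite ltr_norml.
have := Hd2 (mdist p.2 q.1).
rewrite ger0_norm ?mdist_ge0// mulr0 addr0 => /(_ (le_lt_trans pq12 dd2)).
have := chain_inf_step p.2 q.1 t0T.
have := mm_Lag_gap t p.1 p.2; rewrite -surjective_pairing.
rewrite curve_actionE// lee_fin.
move: pD qD De; rewrite [in ell _ _ _]/mm_Lag/=; lra.
Qed.

(** * Null pairs of the action and connected components *)

Lemma chain_inf_rectifiable t (eta : R -> X) : 0 <= t <= T ->
  {within `[0, 1], continuous eta} -> rectifiable eta ->
  (forall s, 0 <= s <= 1 -> gap t (eta s) = 0) ->
  cinf t (eta 0) (eta 1) = 0.
Proof.
move=> t0T etac [M etaM] gap0; apply/eqP; rewrite eq_le chain_inf_ge0// andbT.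
apply/ler_addgt0Pl => e e0; rewrite addr0.
have M1 : 0 < c * (`|M| + 1) by rewrite mulr_gt0 ?invr_gt0 ?mulr_gt0// ltr_wpDl.
(* Jumps shorter than this threshold, of total length at most [|M| + 1], cost at most e. *)
have [d d0 Hd] := path_uniform etac (divr_gt0 e0 M1).
have [n n0 nd] : exists2 n : nat, 0 < n%:R :> R & n%:R^-1 < d.
  exists (Num.trunc d^-1).+1; first by rewrite ltr0n.
  by rewrite invf_plt ?posrE// -truncn_lt_nat// ltW// invr_gt0.
pose sk (k : nat) : R := k%:R / n%:R.
have sk01 k : (k <= n)%N -> 0 <= sk k <= 1.
  by move=> kn; rewrite divr_ge0//= ler_pdivrMr// mul1r ler_nat.
have skS k : sk k.+1 - sk k = n%:R^-1.
  by rewrite /sk -mulrBl -natrB// subSn// subnn mul1r.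
(* The list of an [itv_partition] omits the left endpoint, hence the shift. *)
pose r := mkseq (sk \o succn) n.
have sz_r : size r = n by rewrite size_mkseq.
have nth_r k : (k <= n)%N -> nth 1 (0 :: r) k = sk k.
  case: k => [_|k kn]; first by rewrite /sk mul0r.
  by rewrite /= nth_mkseq.
have part : itv_partition 0 1 r.
  split; last first.
    by rewrite (last_nth 1) sz_r nth_r// /sk divff ?eqxx ?lt0r_neq0.
  apply/(pathP 1) => k; rewrite sz_r => kn.
  rewrite nth_r ?(ltnW kn)// -[nth _ r k]/(nth 1 (0 :: r) k.+1) nth_r//.
  by rewrite -subr_gt0 skS invr_gt0.
have [cost_eta last_eta] := sum_chain_cost t (eta \o sk) n.
have s0 : sk 0 = 0 by rewrite /sk mul0r.
have sn : sk n = 1 by rewrite /sk divff ?eqxx ?lt0r_neq0.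
have := chain_inf_le (eta 0) (mkseq ((eta \o sk) \o succn) n) t0T.
rewrite /= s0 sn in cost_eta last_eta.
rewrite last_eta -cost_eta => /le_trans; apply.
apply: (@le_trans _ _ (\sum_(0 <= k < n)
    (c * (e / (c * (`|M| + 1)))) * mdist (eta (sk k)) (eta (sk k.+1)))).
  rewrite !big_mkord; apply: ler_sum => k _.
  rewrite /mm_Lag/= gap0 ?sk01 1?ltnW// add0r expr2 -[leRHS]mulrA.
  rewrite ler_wpM2l// ler_wpM2r ?mdist_ge0// ltW// Hd ?sk01// 1?ltnW//.
  by rewrite distrC skS ger0_norm ?invr_ge0 ?ltW.
rewrite -mulr_sumr.
have := etaM r part; rewrite sz_r => len_eta.
have {}len_eta : \sum_(0 <= k < n) mdist (eta (sk k)) (eta (sk k.+1)) <= `|M| + 1.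
  apply: (@le_trans _ _ M); last by rewrite (le_trans (ler_norm M))// lerDl.
  apply: le_trans len_eta; rewrite le_eqVlt; apply/orP; left; apply/eqP.
  by apply: eq_big_nat => k /andP[_ kn]; rewrite !nth_r// ltnW.
have c_gt0 : 0 < c by rewrite invr_gt0 mulr_gt0.
have Mgt0 : 0 < `|M| + 1 by rewrite ltr_wpDl.
have -> : c * (e / (c * (`|M| + 1))) = e / (`|M| + 1).
  move: c (lt0r_neq0 c_gt0) => a a0.
  by rewrite invfM mulrCA [a * _]mulrA divff// mul1r.
by rewrite mulrAC ler_pdivrMr// ler_pM2l.
Qed.

(** By compactness of the sublevel: around a zero of the gap that zero serves for all nearby points,
    and around any other point the gap exceeds half its value there. *)
Lemma near_critical t (B r : R) : 0 <= t <= T -> compact_sublevels T E -> 0 < r ->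
  exists2 e : R, 0 < e & forall y, E t y <= B -> gap t y < e ->
    exists2 k, gap t k = 0 & mdist k y < r.
Proof.
move=> t0T Ecpt r0; have [S cS HS] := sublevel_compact B Ecpt.
have := (compact_near_coveringP S).1 cS R (0^'+)
  (fun d y => gap t y < d -> exists2 k, gap t k = 0 & mdist k y < r) _.
case=> [y Sy|d d0 Hd].
  have [gy|/eqP gy] := eqVneq (gap t y) 0.
    exists (ball y r, setT); first by split; [exact: nbhsx_ballx|exact: filterT].
    by move=> [z d] /= [yz _] _; exists y => //; rewrite ballEmdist in yz.
  have gy0 : 0 < gap t y by rewrite lt_neqAle eq_sym mm_gap_ge0// andbT; apply/eqP.
  have gy2 : 0 < gap t y / 2 by rewrite divr_gt0.
  have [d d0 Hd] := (continuous_mdistP _).1 (mm_gap_space_continuous t0T) y _ gy2.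
  exists (ball y d, [set r | r < gap t y / 2]).
    by split; [exact: nbhsx_ballx|exact: nbhs_right_lt].
  move=> [z d'] /= [yz d'y] gz; rewrite ballEmdist in yz.
  by exfalso; have := Hd z yz; rewrite ltr_norml; move: gz d'y; lra.
exists (d / 2); first by rewrite divr_gt0.
move=> y yB; apply: (Hd (d / 2)) => //=; [|by rewrite divr_gt0|exact: HS yB].
rewrite sub0r normrN ger0_norm ?divr_ge0 ?ltW//.
by rewrite ltr_pdivrMr// mulr2n mulrDr mulr1 ltrDl.
Qed.

(* Each point of a cheap chain is within delta / 3 of a critical point and each jump
   is shorter than delta / 3, so that the nearby critical points stay in A. *)
Lemma chain_stays_near (F : set (set X)) (A : set X) (delta : R) t x y :
  0 <= t <= T -> compact_sublevels T E ->
  (forall z, gap t z = 0 <-> (\bigcup_(K in F) K) z) ->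
  0 < delta ->
  (forall x y, A x -> (\bigcup_(K' in F `\ A) K') y -> delta <= mdist x y) ->
  A x -> gap t y = 0 -> cinf t x y = 0 -> A y.
Proof.
move=> t0T Ecpt gapF delta0 Asep Ax gy cxy.
have r0 : 0 < delta / 3 by rewrite divr_gt0.
have [e e0 He] := near_critical (E t y + 1) t0T Ecpt r0.
have c_gt0 : 0 < c by rewrite invr_gt0 mulr_gt0.
have inA k z : gap t z = 0 -> A k -> mdist k z < delta -> A z.
  move=> /gapF[K' FK' K'z] Ak kz; apply: contrapT => nAz.
  have : delta <= mdist k z.
    by apply: Asep => //; exists K' => //; split => // K'A; apply: nAz; rewrite -K'A.
  by rewrite leNgt kz.
(* The three bounds keep the energies below E(y) + 1, the gaps below [e], and the jumps shorter than
   delta / 3. *)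
pose m := Num.min 1 (Num.min e (c * (delta / 3) ^+ 2)).
have m0 : 0 < m by rewrite !lt_min ltr01 e0 mulr_gt0// exprn_gt0.
have [|s xs sm] := @chain_inf_lt t x y m t0T; first by rewrite cxy.
(* The induction needs a start that is merely close to [A], since later points of the chain need not
   be critical. *)
have stays z : (exists2 k, A k & mdist k z < delta / 3) ->
    last z s = y -> cost t z s < m -> A y.
  elim: s z {x Ax cxy xs sm} => [|w s IH] z [k Ak kz]/=.
    by move=> zy _; apply: (inA k) => //; rewrite -zy; move: kz; lra.
  move=> ws; rewrite !lt_min => /and3P[s1 se sc].
  have l0 := mm_Lag_ge0 (z, w) t0T; have s0 := chain_cost_ge0 w s t0T.
  have zw : mdist z w < delta / 3.
    have := mm_Lag_jump z w t0T => jump.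
    have : c * mdist z w ^+ 2 < c * (delta / 3) ^+ 2 by move: jump s0 sc; lra.
    by rewrite ltr_pM2l// ltr_pXn2r ?nnegrE ?mdist_ge0// ltW.
  have [||k' gk' k'w] := He w.
  - by have := chain_cost_ge w s t0T; rewrite ws; move: l0 s1; lra.
  - by have := chain_gap_le w s t0T; rewrite ws gy; move: l0 se; lra.
  apply: (IH w) => //.
    exists k' => //; apply: (inA k) => //.
    have := metric_triangle k z k'; have := metric_triangle z w k'.
    by rewrite (metric_sym w k'); move: kz zw k'w; lra.
  by rewrite !lt_min; apply/and3P; split; move: l0 s1 se sc; lra.
by apply: (stays x) => //; exists x => //; rewrite mdistxx.
Qed.

(** The trace of [A] on the connected set is nonempty, closed since [A] is compact, and relatively
    open since the delta-neighbourhood of [A] meets no other member of [F]. *)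
Lemma connected_stays (F : set (set X)) (A C' : set X) (delta : R) x y :
  compact A -> 0 < delta ->
  (forall x y, A x -> (\bigcup_(K' in F `\ A) K') y -> delta <= mdist x y) ->
  C' `<=` \bigcup_(K in F) K -> connected C' -> C' x -> A x -> C' y -> A y.
Proof.
move=> cA delta0 Asep CF conC C'x Ax C'y.
suff CA : C' `&` A = C' by move: C'y; rewrite -CA => -[].
apply: conC; first by exists x.
  exists [set z | exists2 k, A k & mdist k z < delta].
    rewrite openE => z [k Ak kz]; apply/nbhs_mdistP.
    exists (delta - mdist k z); first by rewrite subr_gt0.
    move=> w; rewrite ltrBrDl => zw; exists k => //.
    exact: le_lt_trans (metric_triangle k z w) zw.
  apply/seteqP; split=> z [C'z].
    by move=> Az; split => //; exists z => //; rewrite mdistxx.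
  move=> [k Ak kz]; split => //; apply: contrapT => nAz.
  have [K' FK' K'z] := CF _ C'z.
  have : delta <= mdist k z.
    by apply: Asep => //; exists K' => //; split => // K'A; apply: nAz; rewrite -K'A.
  by rewrite leNgt kz.
by exists A => //; apply: compact_closed => //; exact: metric_hausdorff.
Qed.

Lemma mm_action_null t x y : 0 <= t <= T -> compact_sublevels T E ->
  separated_critical_sets T E -> (forall z, Crit E t z <-> gap t z = 0) ->
  x <> y ->
  mm_action E tau t x y = 0 <->
  connected_component [set p | mm_Lag E tau t p = 0] (mm_diag x) (mm_diag y).
Proof.
move=> t0T Ecpt /(_ t t0T)[[F [critF _ Fsep Fcpt Fpath]] _] crit_gap0 xy.
have gapF z : gap t z = 0 <-> (\bigcup_(K in F) K) z by rewrite -critF -crit_gap0.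
have Lag0 z : mm_Lag E tau t (mm_diag z) = 0 <-> gap t z = 0.
  by rewrite mm_Lag_self.
rewrite mm_actionE// mm_Lag_self; split.
- move=> /eqP; rewrite paddr_eq0 ?chain_inf_ge0 ?mm_gap_ge0//.
  move=> /andP[/eqP cxy /eqP gy].
  (* The first summand of a chain already contains the gap at [x], and there are chains of
     arbitrarily small cost. *)
  have gx : gap t x = 0.
    apply/eqP; rewrite eq_le mm_gap_ge0// andbT; apply/ler_addgt0Pl => e e0.
    have [|s xs se] := @chain_inf_lt t x y e t0T; first by rewrite cxy.
    by rewrite addr0 (le_trans (chain_gap_le x s t0T))// xs gy add0r ltW.
  have [A FA Ax] := (gapF x).1 gx.
  have [delta delta0 Asep] := Fsep A FA.
  have Ay := chain_stays_near t0T Ecpt gapF delta0 Asep Ax gy cxy.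
  have [eta [etac eta0 eta1 etaA] _] := Fpath A x y FA Ax Ay.
  apply: (@connected_component_max _ _ ((@mm_diag R X \o eta) @` `[0, 1])).
  + by exists 0; rewrite /= ?eta0// in_itv/= lexx ler01.
  + move=> _ [s /= s01 <-]; apply/Lag0/gapF; exists A => //.
    by apply: etaA; rewrite in_itv in s01.
  + apply: connected_continuous_connected; first exact: segment_connected.
    move=> s; apply: (@continuous_comp _ _ _ (eta : subspace `[0, 1] -> X)).
      exact: etac.
    exact: mm_diag_continuous.
  + by exists 1; rewrite /= ?eta1// in_itv/= lexx ler01.
- move=> [D [Dx DZ conD] Dy].
  (* Projection to [X] preserves connectedness and maps zeros of the Lagrangian to zeros of the
     gap. *)
  pose D' := fst @` D.
  have D'gap z : D' z -> gap t z = 0.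
    by move=> [p /DZ /= + <-]; rewrite mm_Lag_eq0// => -[].
  have D'x : D' x by exists (mm_diag x).
  have D'y : D' y by exists (mm_diag y).
  have conD' : connected D'.
    apply: connected_continuous_connected => //.
    by apply: continuous_subspaceT; exact: mean_fst_continuous.
  have [A FA Ax] := (gapF x).1 (D'gap x D'x).
  have [delta delta0 Asep] := Fsep A FA.
  have D'F : D' `<=` \bigcup_(K in F) K by move=> z /D'gap /gapF.
  have Ay := connected_stays (Fcpt A FA) delta0 Asep D'F conD' D'x Ax D'y.
  have [eta [etac eta0 eta1 etaA] rect] := Fpath A x y FA Ax Ay.
  rewrite (D'gap y D'y) addr0 -eta0 -eta1; apply: chain_inf_rectifiable => // s s01.
  by apply/gapF; exists A => //; exact: etaA.
Qed.

End MinimizingMovements.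

Theorem proposition4p5 (R : realType) (X : metricType R) (T : R)
    (E : R -> X -> R) (L tau : R) (omega : R -> X -> X)
    (T_gt0 : 0 < T)
    (X_locally_compact : locally_compact [set: X])
    (E_regular : regular_energy T E)
    (E_power : power_control T E)
    (E_compact : compact_sublevels T E)
    (E_critical : separated_critical_sets T E)
    (X_path_space : @path_space R X)
    (L_gt0 : 0 < L)
    (E_lipschitz : lipschitz_slope T E L)
    (tau_gt0 : 0 < tau)
    (omega_rule : mm_transition_rule T E tau omega) :
  (is_action T E (mm_action E tau) /\
   compatible T E (mm_action E tau) omega) /\
  (tau <= 1 / L ->
   is_action T E (mm_action E tau) /\
   @generated_by_curves R X T E (mm_action E tau)
     IntTime (mean_prod X) (@mm_curves R X) (@mm_diag R X) (mm_Lag E tau)).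
Proof.
have [C [K [C_gt0 E_ge E_gronwall]]] := energy_gronwall E_regular E_power.
have E_continuous := energy_joint_continuous E_regular.
have argmin_neq0 t x : 0 <= t <= T -> mm_argmin E tau t x !=set0.
  by move=> /(omega_rule t x)[u [<- umin _]]; exists (u 1%N); exact: umin.
have action : is_action T E (mm_action E tau) 
  by exact: (mm_action_is_action tau_gt0 C_gt0 E_ge E_gronwall).
split; first by split => //; exact: (mm_action_compatible tau_gt0 C_gt0 E_ge E_gronwall).
move=> tauL; split=> //.
(* The bound on [tau] enters here, in the direction from critical points to zeros of the gap. *)
have critE t x : 0 <= t <= T -> Crit E t x <-> E t x - mm_envelope E tau t x = 0.
  move=> t0T; split; last exact: (gap_crit tau_gt0 E_ge).
  exact: (crit_gap tau_gt0 E_ge argmin_neq0 X_path_space E_regular L_gt0 E_lipschitz).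
split.
- exact: mm_curves_ext.
- by move=> p q g [].
- exact: mm_diag_closed_immersion.
- by move=> t p; exact: (mm_Lag_ge0 tau_gt0 E_ge).
- exact: (mm_Lag_continuous tau_gt0 C_gt0 E_ge E_gronwall).
- by move=> t x y t0T; rewrite (mm_actionE tau_gt0 E_ge)// (curve_actionE tau_gt0 E_ge).
- exact: mm_curves_restrict.
- exact: mm_curves_concat.
- exact: mm_curves_shift.
- move=> t p t0T; rewrite (mm_Lag_eq0 tau_gt0 E_ge)//.
  split=> [[gp px]|[x /critE gx ->]].
    by exists p.1 => //; apply/critE.
  by split => //; exact: gx.
- move=> t x y t0T.
  by apply: (mm_action_null tau_gt0 C_gt0 E_ge E_gronwall) => // z; exact: critE.
- move=> A; apply: (mm_curves_compact tau_gt0 C_gt0 E_ge E_gronwall) => //.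
  exact: ltW.
- by move=> t t0T A e; exact: (mm_curves_local tau_gt0 C_gt0 E_ge E_gronwall).
Qed.
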